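(* Let $\mathbf{k}$ be a field of characteristic $p>0$ and let $d\ge 0$, $n\ge 1$ be integers. There are equivalences of abelian categories $\mathcal{P}_{d,n}\simeq S(n,d)\text{-mod}$ and $\mathcal{P}_{d,n}\simeq \operatorname{GL}_n^{\mathrm{Pol},d}\text{-mod}$. In particular, $\mathcal{P}_{d,n}\simeq\mathcal{P}_d$ for $n\ge d$.
   Context: $\Gamma^d\mathcal{V}ect_{\mathbf{k}}^{\le n}$ is the category whose objects are the $\mathbf{k}$-linear spaces of dimension at most $n$, with morphisms $\operatorname{Hom}(V,W)=\Gamma^d(\operatorname{Hom}_{\mathbf{k}}(V,W))$ ($\Gamma^d$ is the $d$-th divided power), composition being determined by the natural identification $\Gamma^d\operatorname{Hom}_{\mathbf{k}}(V,W)\simeq \operatorname{Hom}_{\mathbf{k}}(V^{\otimes d},W^{\otimes d})^{\Sigma_d}$. $\mathcal{P}_{d,n}$ is the abelian category of $\mathbf{k}$-linear functors from $\Gamma^d\mathcal{V}ect_{\mathbf{k}}^{\le n}$ to finite dimensional $\mathbf{k}$-vector spaces. $\mathcal{P}_d$ is the category of strict polynomial functors of degree $d$, i.e. the analogous category with all finite dimensional spaces $V$ allowed in the domain. $S(n,d)=\operatorname{End}_{\mathbf{k}[\Sigma_d]}((\mathbf{k}^n)^{\otimes d})\simeq\Gamma^d(\operatorname{End}(\mathbf{k}^n))$ is the Schur algebra and $S(n,d)$-mod is the category of its finite dimensional left modules. $\operatorname{GL}_n$ is regarded as an algebraic group over $\mathbf{k}$, and $\operatorname{GL}_n^{\mathrm{Pol},d}$-mod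 is the category of finite dimensional homogeneous polynomial $\operatorname{GL}_n$-modules of degree $d$. *)

(* Defs.v *)
From HB Require Import structures.
From mathcomp Require Import all_boot all_fingroup all_algebra.
From mathcomp Require Import boolp mpoly.

Set Implicit Arguments.
Unset Strict Implicit.
Unset Printing Implicit Defensive.

Import GRing.Theory.
Local Open Scope ring_scope.

(* Modules over k whose carrier may live in any universe.  The carriers of all *)
(* the ssralg structures share a single universe, which is too small for the   *)
(* natural transformations between functors defined on all finite dimensional  *)
(* vector spaces; hence the morphism spaces below are not lmodTypes.           *)
Record kmod (k : fieldType) := KMod {
  kmod_sort :> Type;
  kzero : kmod_sort;
  kopp : kmod_sort -> kmod_sort;
  kadd : kmod_sort -> kmod_sort -> kmod_sort;
  kscale : k -> kmod_sort -> kmod_sort;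
  kaddA : associative kadd;
  kaddC : commutative kadd;
  kadd0 : left_id kzero kadd;
  kaddN : left_inverse kzero kopp kadd;
  kscaleA : forall a b u, kscale a (kscale b u) = kscale (a * b) u;
  kscale1 : left_id 1 kscale;
  kscaleDr : right_distributive kscale kadd;
  kscaleDl : forall u a b, kscale (a + b) u = kadd (kscale a u) (kscale b u) }.

Arguments kzero {k V} : rename.
Arguments kopp {k V} u : rename.
Arguments kadd {k V} u v : rename.
Arguments kscale {k V} a u : rename.

Definition klinear (k : fieldType) (U V : kmod k) (f : U -> V) : Prop :=
  forall a u v, f (kadd (kscale a u) v) = kadd (kscale a (f u)) (f v).

Section KModTheory.
Variables (k : fieldType).
Implicit Types U V : kmod k.

Lemma kaddI V (u v w : V) : kadd u v = kadd u w -> v = w.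
Proof.
by move/(congr1 (kadd (kopp u))); rewrite !kaddA !kaddN !kadd0.
Qed.

Lemma kaddr0 V (u : V) : kadd u kzero = u.
Proof. by rewrite kaddC kadd0. Qed.

Lemma kscale0 V (u : V) : kscale 0 u = kzero.
Proof. by apply: (@kaddI _ (kscale 0 u)); rewrite -kscaleDl addr0 kaddr0. Qed.

Lemma kscaleN1 V (u : V) : kscale (-1) u = kopp u.
Proof.
by apply: (@kaddI _ u); rewrite -[in LHS](kscale1 u) kscaleA mulr1 -kscaleDl
  subrr kscale0 kaddC kaddN.
Qed.

Section KLinear.
Variables (U V : kmod k) (f : U -> V).
Hypothesis f_lin : klinear f.

Lemma klinearD u v : f (kadd u v) = kadd (f u) (f v).
Proof. by rewrite -[in LHS](kscale1 u) f_lin kscale1. Qed.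

Lemma klinear0 : f kzero = kzero.
Proof. by apply: (@kaddI _ (f kzero)); rewrite -klinearD kadd0 kaddr0. Qed.

Lemma klinearZ a u : f (kscale a u) = kscale a (f u).
Proof. by rewrite -[kscale a u]kaddr0 f_lin klinear0 kaddr0. Qed.

End KLinear.
End KModTheory.

Definition kmod_of (k : fieldType) (V : lmodType k) : kmod k :=
  KMod (@addrA V) (@addrC V) (@add0r V) (@addNr V)
    (@scalerA k V) (@scale1r k V) (@scalerDr k V) (@scalerDl k V).

Section KModProd.
Variables (k : fieldType) (I : Type) (V : I -> kmod k).
Implicit Types u v w : forall i, V i.

Let add u v i := kadd (u i) (v i).
Let opp u i := kopp (u i).
Let scale (a : k) u i := kscale a (u i).

Fact kprod_addA : associative add.
Proof. by move=> u v w; apply: functional_extensionality_dep => i; apply: kaddA. Qed.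
Fact kprod_addC : commutative add.
Proof. by move=> u v; apply: functional_extensionality_dep => i; apply: kaddC. Qed.
Fact kprod_add0 : left_id (fun=> kzero) add.
Proof. by move=> u; apply: functional_extensionality_dep => i; apply: kadd0. Qed.
Fact kprod_addN : left_inverse (fun=> kzero) opp add.
Proof. by move=> u; apply: functional_extensionality_dep => i; apply: kaddN. Qed.
Fact kprod_scaleA a b u : scale a (scale b u) = scale (a * b) u.
Proof. by apply: functional_extensionality_dep => i; apply: kscaleA. Qed.
Fact kprod_scale1 : left_id 1 scale.
Proof. by move=> u; apply: functional_extensionality_dep => i; apply: kscale1. Qed.
Fact kprod_scaleDr : right_distributive scale add.
Proof. by move=> a u v; apply: functional_extensionality_dep => i; apply: kscaleDr. Qed.
Fact kprod_scaleDl u a b : scale (a + b) u = add (scale a u) (scale b u).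
Proof. by apply: functional_extensionality_dep => i; apply: kscaleDl. Qed.

Definition kmod_prod : kmod k :=
  KMod kprod_addA kprod_addC kprod_add0 kprod_addN
    kprod_scaleA kprod_scale1 kprod_scaleDr kprod_scaleDl.

End KModProd.

Record submod (k : fieldType) (V : kmod k) := SubMod {
  submod_pred :> V -> Prop;
  submod0 : submod_pred kzero;
  submodP : forall a u v,
    submod_pred u -> submod_pred v -> submod_pred (kadd (kscale a u) v) }.

Section KModSub.
Variables (k : fieldType) (V : kmod k) (P : submod V).
Local Notation T := {u : V | P u}.
Implicit Types u v w : T.

Lemma ksub_inj u v : sval u = sval v -> u = v.
Proof. by case: u v => [u Pu] [v Pv] /= ?; apply: eq_exist. Qed.

Fact ksub_scale_subproof a u : P (kscale a (sval u)).
Proof.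
by rewrite -[kscale _ _]kaddr0; apply: submodP (svalP u) (submod0 P).
Qed.
Fact ksub_add_subproof u v : P (kadd (sval u) (sval v)).
Proof. by rewrite -[sval u]kscale1; apply: submodP (svalP u) (svalP v). Qed.
Fact ksub_opp_subproof u : P (kopp (sval u)).
Proof. by rewrite -kscaleN1; apply: ksub_scale_subproof. Qed.

Let zero : T := exist _ kzero (submod0 P).
Let opp u : T := exist _ _ (ksub_opp_subproof u).
Let add u v : T := exist _ _ (ksub_add_subproof u v).
Let scale a u : T := exist _ _ (ksub_scale_subproof a u).

Fact ksub_addA : associative add.
Proof. by move=> u v w; apply: ksub_inj; apply: kaddA. Qed.
Fact ksub_addC : commutative add.
Proof. by move=> u v; apply: ksub_inj; apply: kaddC. Qed.
Fact ksub_add0 : left_id zero add.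
Proof. by move=> u; apply: ksub_inj; apply: kadd0. Qed.
Fact ksub_addN : left_inverse zero opp add.
Proof. by move=> u; apply: ksub_inj; apply: kaddN. Qed.
Fact ksub_scaleA a b u : scale a (scale b u) = scale (a * b) u.
Proof. by apply: ksub_inj; apply: kscaleA. Qed.
Fact ksub_scale1 : left_id 1 scale.
Proof. by move=> u; apply: ksub_inj; apply: kscale1. Qed.
Fact ksub_scaleDr : right_distributive scale add.
Proof. by move=> a u v; apply: ksub_inj; apply: kscaleDr. Qed.
Fact ksub_scaleDl u a b : scale (a + b) u = add (scale a u) (scale b u).
Proof. by apply: ksub_inj; apply: kscaleDl. Qed.

Definition kmod_sub : kmod k :=
  KMod ksub_addA ksub_addC ksub_add0 ksub_addN
    ksub_scaleA ksub_scale1 ksub_scaleDr ksub_scaleDl.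

End KModSub.

Record lincat (k : fieldType) := LinCat {
  obj :> Type;
  hom : obj -> obj -> kmod k;
  idm : forall X, hom X X;
  comp : forall X Y Z, hom Y Z -> hom X Y -> hom X Z;
  comp_linl : forall X Y Z (f : hom X Y), klinear (fun g : hom Y Z => comp g f);
  comp_linr : forall X Y Z (g : hom Y Z), klinear (fun f : hom X Y => comp g f);
  compA : forall X Y Z T (h : hom Z T) (g : hom Y Z) (f : hom X Y),
    comp h (comp g f) = comp (comp h g) f;
  comp1l : forall X Y (f : hom X Y), comp (idm Y) f = f;
  comp1r : forall X Y (f : hom X Y), comp f (idm X) = f }.

Arguments hom {k C} X Y : rename.
Arguments idm {k C} X : rename.
Arguments comp {k C X Y Z} g f : rename.

Notation "g \oc f" := (comp g f) (at level 40, left associativity).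

Section AbelianCategory.
Variables (k : fieldType) (C : lincat k).
Implicit Types X Y Z : C.

Definition is_zero_obj Z : Prop :=
  (forall X (f : hom X Z), f = kzero) /\ (forall X (f : hom Z X), f = kzero).

Definition is_biproduct X Y S (i : hom X S) (j : hom Y S)
    (p : hom S X) (q : hom S Y) : Prop :=
  [/\ p \oc i = idm X, q \oc j = idm Y, p \oc j = kzero, q \oc i = kzero
    & kadd (i \oc p) (j \oc q) = idm S].

Definition is_kernel X Y (f : hom X Y) K (i : hom K X) : Prop :=
  f \oc i = kzero /\
  forall Z (g : hom Z X), f \oc g = kzero -> exists! h : hom Z K, i \oc h = g.

Definition is_cokernel X Y (f : hom X Y) Q (q : hom Y Q) : Prop :=
  q \oc f = kzero /\
  forall Z (g : hom Y Z), g \oc f = kzero -> exists! h : hom Q Z, h \oc q = g.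

Definition is_mono X Y (f : hom X Y) : Prop :=
  forall Z (g h : hom Z X), f \oc g = f \oc h -> g = h.

Definition is_epi X Y (f : hom X Y) : Prop :=
  forall Z (g h : hom Y Z), g \oc f = h \oc f -> g = h.

Definition is_abelian : Prop :=
  [/\ (exists Z, is_zero_obj Z) /\
      (forall X Y, exists S (i : hom X S) (j : hom Y S)
         (p : hom S X) (q : hom S Y), is_biproduct i j p q),
      forall X Y (f : hom X Y), exists K (i : hom K X), is_kernel f i,
      forall X Y (f : hom X Y), exists Q (q : hom Y Q), is_cokernel f q,
      forall X Y (f : hom X Y), is_mono f ->
        exists Z (g : hom Y Z), is_kernel g f
    & forall X Y (f : hom X Y), is_epi f ->
        exists Z (g : hom Z X), is_cokernel g f].

End AbelianCategory.

Definition full_sub (k : fieldType) (C : lincat k) (P : C -> Prop) : lincat k :=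
  @LinCat k {X : C | P X} (fun X Y => hom (sval X) (sval Y))
    (fun X => idm (sval X)) (fun X Y Z g f => g \oc f)
    (fun X Y Z => @comp_linl k C (sval X) (sval Y) (sval Z))
    (fun X Y Z => @comp_linr k C (sval X) (sval Y) (sval Z))
    (fun X Y Z T => @compA k C (sval X) (sval Y) (sval Z) (sval T))
    (fun X Y => @comp1l k C (sval X) (sval Y))
    (fun X Y => @comp1r k C (sval X) (sval Y)).

Record linfunctor (k : fieldType) (C D : lincat k) := LinFunctor {
  fobj :> C -> D;
  fmor : forall X Y : C, hom X Y -> hom (fobj X) (fobj Y);
  fmor_lin : forall X Y, klinear (@fmor X Y);
  fmor1 : forall X : C, fmor (idm X) = idm (fobj X);
  fmorM : forall (X Y Z : C) (g : hom Y Z) (f : hom X Y),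
    fmor (g \oc f) = fmor g \oc fmor f }.

Arguments fmor {k C D} F {X Y} f : rename.

Definition id_functor (k : fieldType) (C : lincat k) : linfunctor C C :=
  @LinFunctor k C C (fun X => X) (fun X Y f => f)
    (fun X Y a f g => erefl) (fun X => erefl) (fun X Y Z g f => erefl).

Section FunctorComposition.
Variables (k : fieldType) (C D E : lincat k).
Variables (G : linfunctor D E) (F : linfunctor C D).

Fact comp_functor_lin X Y : klinear (fun f : hom X Y => fmor G (fmor F f)).
Proof. by move=> a f g; rewrite !fmor_lin. Qed.
Fact comp_functor1 X : fmor G (fmor F (idm X)) = idm (G (F X)).
Proof. by rewrite !fmor1. Qed.
Fact comp_functorM X Y Z (g : hom Y Z) (f : hom X Y) :
  fmor G (fmor F (g \oc f)) = fmor G (fmor F g) \oc fmor G (fmor F f).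
Proof. by rewrite !fmorM. Qed.

Definition comp_functor : linfunctor C E :=
  LinFunctor comp_functor_lin comp_functor1 comp_functorM.

End FunctorComposition.

Section NatTrans.
Variables (k : fieldType) (C D : lincat k) (F G : linfunctor C D).

Definition natural (e : forall X : C, hom (F X) (G X)) : Prop :=
  forall X Y (f : hom X Y), e Y \oc fmor F f = fmor G f \oc e X.

Let fam : kmod k := kmod_prod (fun X : C => hom (F X) (G X)).

Fact natural0 : natural (@kzero k fam).
Proof.
by move=> X Y f; rewrite (klinear0 (comp_linl _)) (klinear0 (comp_linr _)).
Qed.

Fact naturalP a (u v : fam) :
  natural u -> natural v -> natural (kadd (kscale a u) v).
Proof. by move=> nu nv X Y f; rewrite comp_linl nu nv -comp_linr. Qed.

Definition nat_trans : kmod k := kmod_sub (SubMod natural0 naturalP).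

End NatTrans.

Section FunctorCategory.
Variables (k : fieldType) (C D : lincat k).
Implicit Types F G H : linfunctor C D.

Fact nt_id_natural F : natural (fun X => idm (F X)).
Proof. by move=> X Y f; rewrite comp1l comp1r. Qed.

Definition nt_id F : nat_trans F F := exist _ _ (@nt_id_natural F).

Fact nt_comp_natural F G H (b : nat_trans G H) (a : nat_trans F G) :
  natural (fun X => sval b X \oc sval a X).
Proof. by move=> X Y f; rewrite -compA (svalP a) !compA (svalP b). Qed.

Definition nt_comp F G H (b : nat_trans G H) (a : nat_trans F G) :
  nat_trans F H := exist _ _ (nt_comp_natural b a).

Lemma nat_transP F G (a b : nat_trans F G) :
  (forall X, sval a X = sval b X) -> a = b.
Proof. by move=> eab; apply: ksub_inj; apply: functional_extensionality_dep. Qed.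

Definition functor_cat : lincat k.
Proof.
refine (@LinCat k (linfunctor C D) (@nat_trans k C D) nt_id nt_comp _ _ _ _ _).
- by move=> F G H c a u v; apply: nat_transP => X; apply: comp_linl.
- by move=> F G H c a u v; apply: nat_transP => X; apply: comp_linr.
- by move=> F G H K c b a; apply: nat_transP => X; apply: compA.
- by move=> F G a; apply: nat_transP => X; apply: comp1l.
- by move=> F G a; apply: nat_transP => X; apply: comp1r.
Defined.

Definition naturally_isomorphic F G : Prop :=
  exists (a : nat_trans F G) (b : nat_trans G F),
    nt_comp b a = nt_id F /\ nt_comp a b = nt_id G.

End FunctorCategory.

Definition linear_equivalence (k : fieldType) (C D : lincat k) : Prop :=
  exists (F : linfunctor C D) (G : linfunctor D C),
    naturally_isomorphic (comp_functor G F) (id_functor C) /\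
    naturally_isomorphic (comp_functor F G) (id_functor D).

(* An equivalence between abelian categories is exact as soon as it is         *)
(* additive.                                                                   *)
Definition abelian_equivalence (k : fieldType) (C D : lincat k) : Prop :=
  [/\ is_abelian C, is_abelian D & linear_equivalence C D].

Definition lfun_kmod (k : fieldType) (V W : vectType k) : kmod k :=
  kmod_of 'Hom(V, W).

Definition vect_cat (k : fieldType) : lincat k.
Proof.
refine (@LinCat k (vectType k) (@lfun_kmod k) (fun V => \1%VF)
  (fun (U V W : vectType k) (g : 'Hom(V, W)) (f : 'Hom(U, V)) => (g \o f)%VF)
  _ _ _ _ _).
- by move=> U V W h a f g; rewrite /= comp_lfunDl comp_lfunZl.
- by move=> U V W h a f g; rewrite /= comp_lfunDr comp_lfunZr.
- by move=> U V W S h g f; rewrite comp_lfunA.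
- by move=> U V f; rewrite comp_lfun1l.
- by move=> U V f; rewrite comp_lfun1r.
Defined.

(* Objects are spaces with some extra structure (U forgets it); the morphisms *)
(* are the linear maps that satisfy P.                                        *)
Section ConcreteCategory.
Variables (k : fieldType) (T : Type) (U : T -> vectType k).
Variable P : forall X Y : T, submod (lfun_kmod (U X) (U Y)).
Hypothesis P1 : forall X, P X X \1%VF.
Hypothesis PM : forall X Y Z (g : 'Hom(U Y, U Z)) (f : 'Hom(U X, U Y)),
  P Y Z g -> P X Y f -> P X Z (g \o f)%VF.

Definition concrete_cat : lincat k.
Proof.
refine (@LinCat k T (fun X Y => kmod_sub (P X Y)) (fun X => exist _ _ (P1 X))
  (fun X Y Z g f => exist _ _ (PM (svalP g) (svalP f))) _ _ _ _ _).
- by move=> X Y Z h a f g; apply: ksub_inj; rewrite /= comp_lfunDl comp_lfunZl.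
- by move=> X Y Z h a f g; apply: ksub_inj; rewrite /= comp_lfunDr comp_lfunZr.
- by move=> X Y Z S h g f; apply: ksub_inj; rewrite /= comp_lfunA.
- by move=> X Y f; apply: ksub_inj; rewrite /= comp_lfun1l.
- by move=> X Y f; apply: ksub_inj; rewrite /= comp_lfun1r.
Defined.

End ConcreteCategory.

(* The d-th tensor power of V, in coordinates: the basis                      *)
(* e_(I 1) (x) ... (x) e_(I d) is indexed by the functions I from 'I_d to the *)
(* index set of the basis e = vbasis {:V} of V.                               *)
Definition tpow (k : fieldType) (d : nat) (V : vectType k) : vectType k :=
  {ffun {ffun 'I_d -> 'I_(\dim {:V})} -> k^o}.

Section TensorPower.
Variables (k : fieldType) (d : nat).
Implicit Types U V W : vectType k.

Local Notation bas V := (vbasis {:V}).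
Local Notation crd V := (coord (vbasis {:V})).

(* v 1 (x) ... (x) v d *)
Definition ptens V (v : 'I_d -> V) : tpow d V :=
  [ffun I : {ffun 'I_d -> 'I_(\dim {:V})} => \prod_j crd V (I j) (v j)].

Definition tlift_fun V W (phi : ('I_d -> V) -> W) (x : tpow d V) : W :=
  \sum_(I : {ffun 'I_d -> 'I_(\dim {:V})})
    (x I : k) *: phi (fun j => (bas V)`_(I j)).

Fact tlift_fun_linear V W (phi : ('I_d -> V) -> W) : linear (tlift_fun phi).
Proof.
move=> a x y; rewrite /tlift_fun scaler_sumr -big_split /=.
by apply: eq_bigr => I _; rewrite !ffunE scalerDl scalerA.
Qed.
HB.instance Definition _ V W (phi : ('I_d -> V) -> W) :=
  GRing.isLinear.Build k (tpow d V) W _ (tlift_fun phi) (tlift_fun_linear phi).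

(* The linear map on V^(x)d induced by a multilinear map phi. *)
Definition tlift V W (phi : ('I_d -> V) -> W) : 'Hom(tpow d V, W) :=
  linfun (tlift_fun phi).

Definition tmap V W (f : 'I_d -> 'Hom(V, W)) : 'Hom(tpow d V, tpow d W) :=
  tlift (fun v => ptens (fun j => f j (v j))).

(* The place permutation v 1 (x) ... (x) v d |-> v (s 1) (x) ... (x) v (s d). *)
Definition tperm_lfun V (s : 'S_d) : 'End(tpow d V) :=
  tlift (fun v => ptens (fun j => v (s j))).

(* The divided power Gamma^d V, as the space of symmetric tensors.             *)
Definition dpow V : {vspace tpow d V} :=
  (\bigcap_(s : 'S_d) fixedSpace (tperm_lfun V s))%VS.

(* The canonical map Hom(V, W)^(x)d -> Hom(V^(x)d, W^(x)d). *)
Definition hom_tens V W : 'Hom(tpow d 'Hom(V, W), 'Hom(tpow d V, tpow d W)) :=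
  tlift (@tmap V W).

Definition tcomm V W (s : 'S_d) (f : 'Hom(tpow d V, tpow d W)) :
    'Hom(tpow d V, tpow d W) :=
  (f \o tperm_lfun V s)%VF - (tperm_lfun W s \o f)%VF.

Fact tcomm_linear V W s : linear (@tcomm V W s).
Proof.
move=> a f g; rewrite /tcomm comp_lfunDl comp_lfunDr -comp_lfunZl -comp_lfunZr.
by rewrite opprD addrACA -scalerBr.
Qed.
HB.instance Definition _ V W s :=
  GRing.isLinear.Build k 'Hom(tpow d V, tpow d W) 'Hom(tpow d V, tpow d W)
    _ (@tcomm V W s) (tcomm_linear s).

(* Hom(V^(x)d, W^(x)d)^(Sigma_d), see equivariantP. *)
Definition equivariant V W : {vspace 'Hom(tpow d V, tpow d W)} :=
  (\bigcap_(s : 'S_d) lker (linfun (@tcomm V W s)))%VS.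

Lemma crd_sum V (v : V) : v = \sum_i crd V i v *: (bas V)`_i.
Proof. by rewrite -coord_vbasis ?memvf. Qed.

Lemma crd_bas V (i j : 'I_(\dim {:V})) : crd V i (bas V)`_j = (i == j)%:R.
Proof.
by rewrite coord_free ?(basis_free (vbasisP _)) // eq_sym.
Qed.

Lemma tliftE V W (phi : ('I_d -> V) -> W) x :
  tlift phi x =
  \sum_(I : {ffun 'I_d -> 'I_(\dim {:V})})
    (x I : k) *: phi (fun j => (bas V)`_(I j)).
Proof. by rewrite lfunE. Qed.

Lemma ptens_bas V (I J : {ffun 'I_d -> 'I_(\dim {:V})}) :
  ptens (fun j => (bas V)`_(I j)) J = (J == I)%:R :> k.
Proof.
rewrite ffunE; have [-> | neJI] := eqVneq J I.
  by rewrite big1 // => j _; rewrite crd_bas eqxx.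
have [j neIj] : exists j, J j != I j.
  apply/existsP; apply: contraNT neJI; rewrite negb_exists => /forallP eIJ.
  by apply/eqP/ffunP => j; apply/eqP/negPn/eIJ.
by rewrite (bigD1 j) //= crd_bas (negPf neIj) mul0r.
Qed.

Lemma tpow_sum V (x : tpow d V) :
  x = \sum_(I : {ffun 'I_d -> 'I_(\dim {:V})})
        (x I : k) *: ptens (fun j => (bas V)`_(I j)).
Proof.
apply/ffunP => J; rewrite sum_ffunE (bigD1 J) //= ffunE ptens_bas eqxx.
rewrite big1 ?addr0; first by rewrite [RHS]mulr1.
by move=> I neIJ; rewrite ffunE ptens_bas eq_sym (negPf neIJ) scaler0.
Qed.

Lemma tpow_lfunP V W (f g : 'Hom(tpow d V, W)) :
  (forall v : 'I_d -> V, f (ptens v) = g (ptens v)) -> f = g.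
Proof.
move=> efg; apply/lfunP => x; rewrite (tpow_sum x) !linear_sum.
by apply: eq_bigr => I _; rewrite !linearZ /= efg.
Qed.

Lemma ptens_sum (T : finType) V (a : 'I_d -> T -> k) (w : 'I_d -> T -> V) :
  ptens (fun j => \sum_i a j i *: w j i) =
  \sum_(I : {ffun 'I_d -> T}) (\prod_j a j (I j)) *: ptens (fun j => w j (I j)).
Proof.
apply/ffunP => J; rewrite sum_ffunE ffunE.
under eq_bigr => j _.
  rewrite linear_sum; under eq_bigr => i _ do rewrite linearZ /=.
  over.
rewrite bigA_distr_bigA /=; apply: eq_bigr => I _.
by rewrite !ffunE big_split.
Qed.

Lemma tmapE V W (f : 'I_d -> 'Hom(V, W)) v :
  tmap f (ptens v) = ptens (fun j => f j (v j)).
Proof.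
rewrite tliftE.
have -> : (fun j => f j (v j)) =
    (fun j => \sum_i crd V i (v j) *: f j (bas V)`_i).
  apply: functional_extensionality_dep => j.
  by rewrite [in LHS](crd_sum (v j)) linear_sum; apply: eq_bigr => i _;
     rewrite linearZ.
by rewrite ptens_sum; apply: eq_bigr => I _; rewrite ffunE.
Qed.

Lemma tperm_lfunE V s (v : 'I_d -> V) :
  tperm_lfun V s (ptens v) = ptens (fun j => v (s j)).
Proof.
rewrite tliftE.
have -> : (fun j => v (s j)) =
    (fun j => \sum_i crd V i (v (s j)) *: (bas V)`_i).
  by apply: functional_extensionality_dep => j; rewrite -crd_sum.
rewrite ptens_sum.
rewrite [RHS](reindex_onto
  (fun I : {ffun 'I_d -> 'I_(\dim {:V})} => [ffun j => I (s j)])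
  (fun I => [ffun j => I ((s^-1)%g j)])) /=; last first.
  by move=> I _; apply/ffunP => j; rewrite !ffunE permK.
rewrite [RHS](eq_bigl xpredT); last first.
  by move=> I; apply/eqP/ffunP => j; rewrite !ffunE permKV.
apply: eq_bigr => I _; rewrite ffunE; congr (_ *: ptens _).
  by rewrite (reindex_perm s) /=; apply: eq_bigr => j _; rewrite ffunE.
by apply: functional_extensionality_dep => j; rewrite ffunE.
Qed.

Lemma hom_tensE V W (f : 'I_d -> 'Hom(V, W)) : hom_tens V W (ptens f) = tmap f.
Proof.
apply: tpow_lfunP => v; rewrite tmapE tliftE sum_lfunE.
have -> : (fun j => f j (v j)) =
    (fun j => \sum_i crd 'Hom(V, W) i (f j) *: (bas 'Hom(V, W))`_i (v j)).
  apply: functional_extensionality_dep => j.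
  by rewrite [in LHS](crd_sum (f j)) sum_lfunE; apply: eq_bigr => i _;
     rewrite scale_lfunE.
rewrite ptens_sum; apply: eq_bigr => I _.
by rewrite scale_lfunE ffunE tmapE.
Qed.

Lemma tperm_lfunK V s : (tperm_lfun V s \o tperm_lfun V s^-1)%VF = \1%VF.
Proof.
apply: tpow_lfunP => v; rewrite comp_lfunE id_lfunE !tperm_lfunE.
by congr ptens; apply: functional_extensionality_dep => j; rewrite permK.
Qed.

Lemma hom_tens_perm V W s t :
  hom_tens V W (tperm_lfun _ s t) =
  (tperm_lfun W s \o hom_tens V W t \o tperm_lfun V s^-1)%VF.
Proof.
apply/lfunP => x; rewrite !comp_lfunE (tpow_sum t) !linear_sum !sum_lfunE.
rewrite linear_sum; apply: eq_bigr => I _.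
rewrite !linearZ /= !scale_lfunE linearZ /=; congr (_ *: _).
rewrite tperm_lfunE !hom_tensE -!comp_lfunE; congr (fun_of_lfun _ x).
apply: tpow_lfunP => v; rewrite !comp_lfunE !(tperm_lfunE, tmapE).
by congr ptens; apply: functional_extensionality_dep => j; rewrite permK.
Qed.

Lemma ptensZ V (a : 'I_d -> k) (v : 'I_d -> V) :
  ptens (fun j => a j *: v j) = (\prod_j a j) *: ptens v.
Proof.
apply/ffunP => J; rewrite !ffunE -[RHS]big_split /=.
by apply: eq_bigr => j _; rewrite linearZ.
Qed.

Let rank1 V W (i : 'I_(\dim {:V})) (w : W) (v : V) : W := crd V i v *: w.

Fact rank1_linear V W i (w : W) : linear (@rank1 V W i w).
Proof. by move=> a u v; rewrite /rank1 linearP scalerDl scalerA. Qed.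
HB.instance Definition _ V W i (w : W) :=
  GRing.isLinear.Build k V W _ (@rank1 V W i w) (rank1_linear i w).

Lemma limg_hom_tens V W : limg (hom_tens V W) = fullv.
Proof.
apply/vspaceP => g; rewrite memvf; apply/memv_imgP.
pose E (I : {ffun 'I_d -> 'I_(\dim {:V})}) (J : {ffun 'I_d -> 'I_(\dim {:W})}) :
  'I_d -> 'Hom(V, W) := fun j => linfun (rank1 (I j) (bas W)`_(J j)).
exists (\sum_(I : {ffun 'I_d -> 'I_(\dim {:V})})
        \sum_(J : {ffun 'I_d -> 'I_(\dim {:W})})
          (g (ptens (fun j => (bas V)`_(I j))) J : k) *: ptens (E I J)).
  exact: memvf.
apply: tpow_lfunP => v.
rewrite [in LHS](tpow_sum (ptens v)) !linear_sum sum_lfunE.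
apply: eq_bigr => I _; rewrite linear_sum sum_lfunE linearZ /=.
rewrite [in LHS](tpow_sum (g _)) scaler_sumr; apply: eq_bigr => J _.
rewrite [in RHS]linearZ /= scale_lfunE hom_tensE tmapE /E.
rewrite scalerA mulrC -scalerA; congr (_ *: _).
rewrite ffunE -ptensZ; congr ptens.
apply: functional_extensionality_dep => j; rewrite lfunE //=.
Qed.

Lemma lker_hom_tens V W : lker (hom_tens V W) = 0%VS.
Proof.
have dimT U : \dim {:tpow d U} = (\dim {:U} ^ d)%N.
  by rewrite dimvf /dim /= card_ffun !card_ord muln1.
apply/eqP; rewrite -dimv_eq0; have := limg_ker_dim (hom_tens V W) fullv.
rewrite limg_hom_tens capfv dimT [\dim {: 'Hom(tpow d V, _)}]dimvf.
rewrite -[dim 'Hom(tpow d V, tpow d W)]/(dim (tpow d V) * dim (tpow d W))%N.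
rewrite -!dimvf !dimT -expnMn [\dim {: 'Hom(V, W)}]dimvf !dimvf => /eqP.
by rewrite -[X in _ == X]add0n eqn_add2r.
Qed.

Lemma hom_tensK V W : cancel (hom_tens V W) (hom_tens V W)^-1%VF.
Proof. by apply/lker0_lfunK/eqP/lker_hom_tens. Qed.

Lemma hom_tensVK V W : cancel (hom_tens V W)^-1%VF (hom_tens V W).
Proof. by move=> f; apply: limg_lfunVK; rewrite limg_hom_tens memvf. Qed.

Lemma dpowP V t : reflect (forall s, tperm_lfun V s t = t) (t \in dpow V).
Proof.
rewrite memvE; apply: (iffP subv_bigcapP) => [tinv s | tinv s _].
  by apply/fixedSpaceP; rewrite memvE tinv.
by rewrite -memvE; apply/fixedSpaceP.
Qed.

Lemma equivariantP V W (f : 'Hom(tpow d V, tpow d W)) :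
  reflect (forall s, f \o tperm_lfun V s = tperm_lfun W s \o f)%VF
          (f \in equivariant V W).
Proof.
rewrite memvE; apply: (iffP subv_bigcapP) => [finv s | finv s _].
  apply/eqP; rewrite -subr_eq0.
  by have := finv s isT; rewrite -memvE memv_ker lfunE.
by rewrite -memvE memv_ker lfunE /= /tcomm finv subrr.
Qed.

Lemma hom_tens_equivariant V W t :
  t \in dpow 'Hom(V, W) -> hom_tens V W t \in equivariant V W.
Proof.
move=> /dpowP tinv; apply/equivariantP => s.
rewrite -[in LHS](tinv s) hom_tens_perm -!comp_lfunA.
have := tperm_lfunK V s^-1; rewrite invgK => ->.
by rewrite comp_lfun1r.
Qed.

Lemma hom_tensV_dpow V W f :
  f \in equivariant V W -> (hom_tens V W)^-1%VF f \in dpow 'Hom(V, W).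
Proof.
move=> /equivariantP finv; apply/dpowP => s.
apply: (can_inj (@hom_tensK V W)); rewrite hom_tens_perm hom_tensVK.
by rewrite -finv -comp_lfunA tperm_lfunK comp_lfun1r.
Qed.

Lemma equivariant1 V : \1%VF \in equivariant V V.
Proof. by apply/equivariantP => s; rewrite comp_lfun1l comp_lfun1r. Qed.

Lemma equivariantM U V W (g : 'Hom(tpow d V, tpow d W))
    (f : 'Hom(tpow d U, tpow d V)) :
  g \in equivariant V W -> f \in equivariant U V ->
  (g \o f)%VF \in equivariant U W.
Proof.
move=> /equivariantP ginv /equivariantP finv; apply/equivariantP => s.
by rewrite -comp_lfunA finv !comp_lfunA ginv.
Qed.

End TensorPower.

Section DividedPowerCategory.
Variables (k : fieldType) (d : nat).
Implicit Types U V W : vectType k.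

Definition dhom V W : kmod k := kmod_of (subvs_of (dpow d 'Hom(V, W))).

Definition dhom_id V : dhom V V :=
  vsproj (dpow d 'Hom(V, V)) (ptens (fun=> \1%VF)).

(* Composition is transported from the composition of Sigma_d-equivariant maps *)
(* along the isomorphism hom_tens (dhom_compE); the linear map hom_tens is     *)
(* bijective, and ^-1 is its inverse (hom_tensK, hom_tensVK).                  *)
Definition dhom_comp U V W (g : dhom V W) (f : dhom U V) : dhom U W :=
  vsproj (dpow d 'Hom(U, W))
    ((hom_tens d U W)^-1%VF
       (hom_tens d V W (vsval g) \o hom_tens d U V (vsval f))%VF).

Lemma dhom_inj V W (f g : dhom V W) :
  hom_tens d V W (vsval f) = hom_tens d V W (vsval g) -> f = g.
Proof. by move=> /(can_inj (@hom_tensK k d V W))/val_inj. Qed.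

Lemma dhom_equivariant V W (f : dhom V W) :
  hom_tens d V W (vsval f) \in equivariant d V W.
Proof. exact/hom_tens_equivariant/subvsP. Qed.

Lemma dhom_idE V : hom_tens d V V (vsval (dhom_id V)) = \1%VF.
Proof.
have id_tens : hom_tens d V V (ptens (fun=> \1%VF)) = \1%VF.
  rewrite hom_tensE; apply: tpow_lfunP => v; rewrite tmapE id_lfunE.
  by congr ptens; apply: functional_extensionality_dep => j; rewrite id_lfunE.
rewrite vsprojK // -[ptens _](@hom_tensK k d V V) id_tens.
exact/hom_tensV_dpow/equivariant1.
Qed.

Lemma dhom_compE U V W (g : dhom V W) (f : dhom U V) :
  hom_tens d U W (vsval (dhom_comp g f)) =
  (hom_tens d V W (vsval g) \o hom_tens d U V (vsval f))%VF.
Proof.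
rewrite vsprojK ?hom_tensVK //; apply: hom_tensV_dpow.
by apply: equivariantM; apply: dhom_equivariant.
Qed.

Lemma dhom_linE V W a (f g : dhom V W) :
  hom_tens d V W (vsval (kadd (kscale a f) g)) =
  a *: hom_tens d V W (vsval f) + hom_tens d V W (vsval g).
Proof. by rewrite -linearP -[in RHS]linearP. Qed.

(* The category Gamma^d Vect_k. *)
Definition dpow_vect : lincat k.
Proof.
refine (@LinCat k (vectType k) dhom dhom_id dhom_comp _ _ _ _ _).
- move=> U V W f a g h; apply: dhom_inj.
  by rewrite dhom_linE !dhom_compE dhom_linE comp_lfunDl comp_lfunZl.
- move=> U V W f a g h; apply: dhom_inj.
  by rewrite dhom_linE !dhom_compE dhom_linE comp_lfunDr comp_lfunZr.
- by move=> U V W T h g f; apply: dhom_inj; rewrite !dhom_compE comp_lfunA.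
- by move=> U V f; apply: dhom_inj; rewrite dhom_compE dhom_idE comp_lfun1l.
- by move=> U V f; apply: dhom_inj; rewrite dhom_compE dhom_idE comp_lfun1r.
Defined.

Definition dpow_vect_le (n : nat) : lincat k :=
  @full_sub k dpow_vect (fun V : vectType k => (\dim {:V} <= n)%N).

(* P_d and P_(d,n). *)
Definition polyfun : lincat k := functor_cat dpow_vect (vect_cat k).

Definition polyfun_le (n : nat) : lincat k :=
  functor_cat (dpow_vect_le n) (vect_cat k).

End DividedPowerCategory.

Section SchurAlgebra.
Variables (k : fieldType) (n d : nat).

(* The Schur algebra S(n,d). *)
Definition schur_alg := subvs_of (equivariant d 'rV[k]_n 'rV[k]_n).
HB.instance Definition _ := Vector.on schur_alg.
Implicit Types s t u : schur_alg.

Definition schur_one : schur_alg := vsproj _ \1%VF.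
Definition schur_mul s t : schur_alg := vsproj _ (vsval s \o vsval t)%VF.

Lemma schur_oneE : vsval schur_one = \1%VF.
Proof. by rewrite vsprojK ?equivariant1. Qed.

Lemma schur_mulE s t : vsval (schur_mul s t) = (vsval s \o vsval t)%VF.
Proof. by rewrite vsprojK // equivariantM // subvsP. Qed.

Fact schur_mulA : associative schur_mul.
Proof. by move=> s t u; apply: val_inj; rewrite /= !schur_mulE comp_lfunA. Qed.
Fact schur_mul1l : left_id schur_one schur_mul.
Proof. by move=> s; apply: val_inj; rewrite /= schur_mulE schur_oneE comp_lfun1l. Qed.
Fact schur_mul1r : right_id schur_one schur_mul.
Proof. by move=> s; apply: val_inj; rewrite /= schur_mulE schur_oneE comp_lfun1r. Qed.
Fact schur_mulDl : left_distributive schur_mul +%R.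
Proof.
by move=> s t u; apply: val_inj;
  rewrite linearD /= !schur_mulE linearD /= comp_lfunDl. Qed.
Fact schur_mulDr : right_distributive schur_mul +%R.
Proof.
by move=> s t u; apply: val_inj;
  rewrite linearD /= !schur_mulE linearD /= comp_lfunDr. Qed.

HB.instance Definition _ := GRing.Zmodule_isPzRing.Build schur_alg
  schur_mulA schur_mul1l schur_mul1r schur_mulDl schur_mulDr.

Record schur_module := SchurModule {
  smod_space :> vectType k;
  smod_act : {linear schur_alg -> 'End(smod_space)};
  smod_act1 : smod_act 1 = \1%VF;
  smod_actM : forall s t, smod_act (s * t) = (smod_act s \o smod_act t)%VF }.

Definition schur_equivariant (M N : schur_module) (f : 'Hom(M, N)) : Prop :=
  forall s, (f \o smod_act M s = smod_act N s \o f)%VF.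

Fact schur_equivariant0 (M N : schur_module) : @schur_equivariant M N 0.
Proof. by move=> s; rewrite comp_lfun0l comp_lfun0r. Qed.

Fact schur_equivariantP (M N : schur_module) a (f g : 'Hom(M, N)) :
  schur_equivariant f -> schur_equivariant g -> schur_equivariant (a *: f + g).
Proof.
move=> fM gM s; rewrite comp_lfunDl comp_lfunDr -comp_lfunZl -comp_lfunZr.
by rewrite fM gM.
Qed.

Definition schur_submod (M N : schur_module) : submod (lfun_kmod M N) :=
  @SubMod k (lfun_kmod M N) (@schur_equivariant M N)
    (@schur_equivariant0 M N) (@schur_equivariantP M N).

Fact schur_equivariant1 (M : schur_module) : schur_submod M M \1%VF.
Proof. by move=> s; rewrite comp_lfun1l comp_lfun1r. Qed.

Fact schur_equivariantM (L M N : schur_module)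
    (g : 'Hom(M, N)) (f : 'Hom(L, M)) :
  schur_submod M N g -> schur_submod L M f -> schur_submod L N (g \o f)%VF.
Proof. by move=> gM fM s; rewrite -comp_lfunA fM !comp_lfunA gM. Qed.

Definition schur_mod : lincat k :=
  concrete_cat schur_equivariant1 schur_equivariantM.

End SchurAlgebra.

Section GLModules.
Variables (k : fieldType) (n : nat).

(* A finite dimensional module over the algebraic group GL_n, that is, a      *)
(* family of actions of the groups GL_n(A) on V (x) A, natural in the         *)
(* commutative k-algebra A.  The action of g is given by its matrix (acting   *)
(* on column vectors) in the basis of V (x) A obtained from vbasis {:V}.      *)
(* Only the values of gl_act on invertible matrices are relevant.             *)
Record gl_module := GLModule {
  gl_space :> vectType k;
  gl_act : forall A : comUnitAlgType k, 'M[A]_n -> 'M[A]_(\dim {:gl_space});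
  gl_act1 : forall A : comUnitAlgType k, gl_act (1%:M : 'M[A]_n) = 1%:M;
  gl_actM : forall (A : comUnitAlgType k) (g h : 'M[A]_n),
    g \in unitmx -> h \in unitmx -> gl_act (g *m h) = gl_act g *m gl_act h;
  gl_act_nat : forall (A B : comUnitAlgType k) (phi : {lrmorphism A -> B})
      (g : 'M[A]_n),
    g \in unitmx -> gl_act (map_mx phi g) = map_mx phi (gl_act g) }.

(* The matrix of f, acting on column vectors. *)
Definition lfun_colmx (V W : vectType k) (f : 'Hom(V, W)) :
    'M[k]_(\dim {:W}, \dim {:V}) :=
  \matrix_(i, j) coord (vbasis {:W}) i (f (vbasis {:V})`_j).

Definition gl_equivariant (V W : gl_module) (f : 'Hom(V, W)) : Prop :=
  forall (A : comUnitAlgType k) (g : 'M[A]_n), g \in unitmx ->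
    map_mx (in_alg A) (lfun_colmx f) *m gl_act V g =
    gl_act W g *m map_mx (in_alg A) (lfun_colmx f).

Lemma lfun_colmx_linear (V W : vectType k) : linear (@lfun_colmx V W).
Proof.
by move=> a f g; apply/matrixP => i j; rewrite !mxE add_lfunE scale_lfunE linearP.
Qed.
HB.instance Definition _ (V W : vectType k) :=
  GRing.isLinear.Build k 'Hom(V, W) 'M[k]_(\dim {:W}, \dim {:V}) _
    (@lfun_colmx V W) (@lfun_colmx_linear V W).

Lemma lfun_colmx1 (V : vectType k) : lfun_colmx (\1%VF : 'End(V)) = 1%:M.
Proof.
apply/matrixP => i j; rewrite !mxE id_lfunE.
by rewrite coord_free ?(basis_free (vbasisP _)) // eq_sym.
Qed.

Lemma lfun_colmxM (U V W : vectType k) (g : 'Hom(V, W)) (f : 'Hom(U, V)) :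
  lfun_colmx (g \o f)%VF = lfun_colmx g *m lfun_colmx f.
Proof.
apply/matrixP => i j; rewrite !mxE comp_lfunE.
rewrite [f _ in LHS](coord_vbasis (memvf _)) !linear_sum.
by apply: eq_bigr => l _; rewrite !mxE !linearZ /= mulrC.
Qed.

Fact gl_equivariant0 (V W : gl_module) : @gl_equivariant V W 0.
Proof. by move=> A g _; rewrite linear0 map_mx0 mul0mx mulmx0. Qed.

Fact gl_equivariantP (V W : gl_module) a (e f : 'Hom(V, W)) :
  gl_equivariant e -> gl_equivariant f -> gl_equivariant (a *: e + f).
Proof.
move=> eV fV A g gU; rewrite linearP /= map_mxD map_mxZ.
by rewrite mulmxDl mulmxDr -scalemxAl -scalemxAr eV // fV.
Qed.

Definition gl_submod (V W : gl_module) : submod (lfun_kmod V W) :=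
  @SubMod k (lfun_kmod V W) (@gl_equivariant V W)
    (@gl_equivariant0 V W) (@gl_equivariantP V W).

Fact gl_equivariant1 (V : gl_module) : gl_submod V V \1%VF.
Proof. by move=> A g _; rewrite lfun_colmx1 map_mx1 mul1mx mulmx1. Qed.

Fact gl_equivariantM (U V W : gl_module) (f : 'Hom(V, W)) (e : 'Hom(U, V)) :
  gl_submod V W f -> gl_submod U V e -> gl_submod U W (f \o e)%VF.
Proof.
move=> fV eV A g gU.
by rewrite lfun_colmxM map_mxM -mulmxA eV // !mulmxA fV.
Qed.

Definition gl_mod : lincat k := concrete_cat gl_equivariant1 gl_equivariantM.

(* The coefficient functions of V are homogeneous polynomials of degree d in  *)
(* the matrix entries; the variable with index mxvec_index i j stands for the *)
(* entry (i, j).                                                              *)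
Definition is_pol_homog (d : nat) (V : gl_module) : Prop :=
  exists P : 'M[{mpoly k[n * n]}]_(\dim {:V}),
    (forall i j, P i j \is d.-homog) /\
    forall (A : comUnitAlgType k) (g : 'M[A]_n), g \in unitmx ->
      gl_act V g =
      map_mx (mmap (in_alg A) (fun l => mxvec g 0 l)) P.

Definition gl_pol_mod (d : nat) : lincat k := @full_sub k gl_mod (is_pol_homog d).

End GLModules.

(* Main.v *)
From HB Require Import structures.
From mathcomp Require Import all_boot all_fingroup all_algebra.
From mathcomp Require Import boolp mpoly.
Require Import Defs.

(** The whole statement is a Morita argument.  Let E be k^n, seen as an object of
    Gamma^d Vect, so that S(n,d) is its endomorphism algebra.  Evaluation at E
    sends a k-linear functor F on a k-linear category to the S(n,d)-module F(E).
    It is an equivalence onto the finite dimensional modules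
    ([evaluation_equiv]) as soon as the identity of every object V can be written
    as a finite sum of endomorphisms g_i f_i that factor through E: such a
    decomposition determines F(V) as the image of the idempotent matrix
    (f_i g_j), whose entries are in S(n,d), acting on a power of F(E), and this
    recipe also extends any S(n,d)-module to a functor.

    In Gamma^d Vect the decomposition exists if dim V <= n or d <= n
    ([dpow_vect_generated]).  The tensor power of V is the direct sum, over the
    sets S of basis vectors of V, of the span of the basis tensors whose set
    of factors is S.  These summands are stable under the symmetric
    group, they vanish when S has more than d elements, and an injection of S into
    the basis of E embeds them into the tensor power of E.  Hence both P_(d,n) and,
    for d <= n, P_d are equivalent to the category of S(n,d)-modules, and they are
    equivalent to each other.

    For GL_n, the tensor power of a matrix g has entries g_(I,J), the product of
    the g_(I_j,J_j), which depends on (I,J) only through the monomial of degree d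
    formed by the pairs (I_j,J_j).  Two pairs (I,J) have the same monomial exactly
    if they are conjugate under the symmetric group ([tmon_eq]), so that the
    matrices [xi m] with entries 1 at the pairs of monomial m, and 0 elsewhere,
    form a basis of S(n,d), and the tensor power of g is the sum of the g^m xi(m),
    over any commutative k-algebra.  Consequently a homogeneous polynomial family
    of matrices P(g), the sum of the g^m P_m, is the same thing as a linear map on
    S(n,d), the one that sends xi(m) to P_m.  This linear map is multiplicative
    when P is: comparing coefficients in P(gh) = P(g)P(h) is possible for two
    generic matrices g and h, which are invertible over the field of fractions of
    the polynomial ring in their entries ([generic_matrices]).  The same comparison
    shows that the two kinds of modules have the same morphisms.  Generic matrices
    are points of the group scheme GL_n, so that they are available even when k is
    finite and GL_n(k) is too small.

    Finally, a category of functors to vector spaces is abelian because exact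
    sequences of vector spaces split, so that kernels and cokernels can be formed
    objectwise ([functor_cat_abelian]); the other categories inherit the property
    through the equivalences ([weak_equiv_abelian]). *)

Set Implicit Arguments.
Unset Strict Implicit.
Unset Printing Implicit Defensive.

Import GRing.Theory.
Local Open Scope ring_scope.

(** * Equivalences of linear categories *)

Section LinearCategory.
Variables (k : fieldType) (C : lincat k).
Implicit Types X Y Z : C.

Lemma comp0l X Y Z (f : hom X Y) : kzero \oc f = kzero :> hom X Z.
Proof. exact: (klinear0 (comp_linl f)). Qed.

Lemma comp0r X Y Z (g : hom Y Z) : g \oc kzero = kzero :> hom X Z.
Proof. exact: (klinear0 (comp_linr g)). Qed.

Definition isomorphic X Y : Prop :=
  exists (u : hom X Y) (v : hom Y X), v \oc u = idm X /\ u \oc v = idm Y.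

End LinearCategory.

Definition faithful k (C D : lincat k) (F : linfunctor C D) : Prop :=
  forall (X Y : C) (f g : hom X Y), fmor F f = fmor F g -> f = g.

Definition full k (C D : lincat k) (F : linfunctor C D) : Prop :=
  forall (X Y : C) (g : hom (F X) (F Y)), exists f : hom X Y, fmor F f = g.

Definition ess_surj k (C D : lincat k) (F : linfunctor C D) : Prop :=
  forall Y : D, exists X : C, isomorphic (F X) Y.

Definition weak_equiv k (C D : lincat k) (F : linfunctor C D) : Prop :=
  [/\ faithful F, full F & ess_surj F].

Lemma fmor0 k (C D : lincat k) (F : linfunctor C D) (X Y : C) :
  fmor F (kzero : hom X Y) = kzero.
Proof. exact: (klinear0 (@fmor_lin _ _ _ F X Y)). Qed.

Section QuasiInverse.
Variables (k : fieldType) (C D : lincat k) (F : linfunctor C D).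
Hypothesis F_equiv : weak_equiv F.

Let Ffaith : faithful F. Proof. by case: F_equiv. Qed.
Let Ffull : full F. Proof. by case: F_equiv. Qed.
Let Fess : ess_surj F. Proof. by case: F_equiv. Qed.

Let pre (X Y : C) (g : hom (F X) (F Y)) : hom X Y := sval (cid (Ffull g)).
Let preK (X Y : C) (g : hom (F X) (F Y)) : fmor F (pre g) = g.
Proof. exact: svalP (cid (Ffull g)). Qed.

Let G0 (Y : D) : C := sval (cid (Fess Y)).
Let G0_iso (Y : D) : isomorphic (F (G0 Y)) Y.
Proof. exact: svalP (cid (Fess Y)). Qed.
Let u (Y : D) : hom (F (G0 Y)) Y := sval (cid (G0_iso Y)).
Let v_ex (Y : D) := svalP (cid (G0_iso Y)).
Let v (Y : D) : hom Y (F (G0 Y)) := sval (cid (v_ex Y)).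
Let vu Y : v Y \oc u Y = idm _.
Proof. by case: (svalP (cid (v_ex Y))). Qed.
Let uv Y : u Y \oc v Y = idm _.
Proof. by case: (svalP (cid (v_ex Y))). Qed.

Let Gmor (X Y : D) (f : hom X Y) : hom (G0 X) (G0 Y) := pre (v Y \oc f \oc u X).
Let FGmor (X Y : D) (f : hom X Y) : fmor F (Gmor f) = v Y \oc f \oc u X.
Proof. exact: preK. Qed.

Fact quasi_inverse_lin X Y : klinear (@Gmor X Y).
Proof.
by move=> a f g; apply: Ffaith; rewrite fmor_lin !FGmor comp_linr comp_linl.
Qed.

Fact quasi_inverse1 X : Gmor (idm X) = idm (G0 X).
Proof. by apply: Ffaith; rewrite FGmor fmor1 comp1r vu. Qed.

Fact quasi_inverseM X Y Z (g : hom Y Z) (f : hom X Y) :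
  Gmor (g \oc f) = Gmor g \oc Gmor f.
Proof.
apply: Ffaith; rewrite fmorM !FGmor.
by rewrite !compA -[v Z \oc g \oc u Y \oc v Y]compA uv comp1r.
Qed.

Let G : linfunctor D C := LinFunctor quasi_inverse_lin quasi_inverse1 quasi_inverseM.

Fact counit_natural : natural (F := comp_functor F G) (G := id_functor D) u.
Proof. by move=> X Y f; rewrite /= FGmor !compA uv comp1l. Qed.

Fact counitV_natural : natural (G := comp_functor F G) (F := id_functor D) v.
Proof. by move=> X Y f; rewrite /= FGmor -!compA uv comp1r. Qed.

Fact unit_natural :
  natural (F := comp_functor G F) (G := id_functor C) (fun X => pre (u (F X))).
Proof.
by move=> X Y f; apply: Ffaith; rewrite /= !fmorM FGmor !preK !compA uv comp1l.
Qed.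

Fact unitV_natural :
  natural (G := comp_functor G F) (F := id_functor C) (fun X => pre (v (F X))).
Proof.
by move=> X Y f; apply: Ffaith; rewrite /= !fmorM FGmor !preK -!compA uv comp1r.
Qed.

(** The quasi-inverse sends an object to a chosen preimage up to isomorphism, and
    a morphism to the preimage of its conjugate by the chosen isomorphisms. *)
Lemma weak_equiv_linear_equivalence : linear_equivalence C D.
Proof.
exists F, G; split.
  exists (exist _ _ unit_natural), (exist _ _ unitV_natural); split.
    by apply: nat_transP => X; apply: Ffaith; rewrite /= fmorM !preK vu fmor1.
  by apply: nat_transP => X; apply: Ffaith; rewrite /= fmorM !preK uv fmor1.
exists (exist _ _ counit_natural), (exist _ _ counitV_natural).
by split; apply: nat_transP => X /=; rewrite (vu, uv).
Qed.

End QuasiInverse.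

Lemma linear_equivalence_sym k (C D : lincat k) :
  linear_equivalence C D -> linear_equivalence D C.
Proof. by move=> [F [G [GF FG]]]; exists G, F. Qed.

Lemma left_inverse_faithful k (C D : lincat k) (F : linfunctor C D)
    (G : linfunctor D C) :
  naturally_isomorphic (comp_functor G F) (id_functor C) -> faithful F.
Proof.
move=> [a [b [ba ab]]] X Y f g eFfg.
have abX Z : sval a Z \oc sval b Z = idm Z.
  by have /(congr1 (fun c => sval c Z)) := ab.
have nat_f (h : hom X Y) : h = sval a Y \oc fmor G (fmor F h) \oc sval b X.
  by rewrite (svalP a X Y h) -compA abX comp1r.
by rewrite (nat_f f) (nat_f g) eFfg.
Qed.

Lemma linear_equivalence_weak k (C D : lincat k) :
  linear_equivalence C D -> exists F : linfunctor C D, weak_equiv F.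
Proof.
move=> [F [G [GF FG]]]; exists F.
have Ffaith := left_inverse_faithful GF.
have Gfaith := left_inverse_faithful FG.
split=> // [X Y g | Y].
  have [a [b [ba ab]]] := GF.
  have abX Z : sval a Z \oc sval b Z = idm Z.
    by have /(congr1 (fun c => sval c Z)) := ab.
  have baX Z : sval b Z \oc sval a Z = idm (G (F Z)).
    by have /(congr1 (fun c => sval c Z)) := ba.
  (* Naturality of [a] forces the preimage of g; as G is faithful, the equation
     can be checked after G, where it is this naturality again. *)
  exists (sval a Y \oc fmor G g \oc sval b X); apply: Gfaith.
  have /= nat_a := svalP a X Y (sval a Y \oc fmor G g \oc sval b X).
  rewrite -[LHS]comp1l -(baX Y) -[LHS]compA nat_a.
  by rewrite -!compA baX comp1r compA baX comp1l.
have [a [b [ba ab]]] := FG.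
exists (G Y); exists (sval a Y), (sval b Y); split.
  by have /(congr1 (fun c => sval c Y)) := ba.
by have /(congr1 (fun c => sval c Y)) := ab.
Qed.

Lemma weak_equiv_comp k (C D E : lincat k) (F : linfunctor C D)
    (G : linfunctor D E) :
  weak_equiv F -> weak_equiv G -> weak_equiv (comp_functor G F).
Proof.
move=> [Ffaith Ffull Fess] [Gfaith Gfull Gess]; split.
- by move=> X Y f g /Gfaith/Ffaith.
- move=> X Y h; have [g <-] := Gfull _ _ h; have [f <-] := Ffull _ _ g.
  by exists f.
move=> Z; have [Y [u [v [vu uv]]]] := Gess Z.
have [X [u' [v' [vu' uv']]]] := Fess Y; exists X.
exists (u \oc fmor G u'), (fmor G v' \oc v); split=> /=.
  by rewrite -compA (compA v) vu comp1l -fmorM vu' fmor1.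
by rewrite -compA (compA (fmor G u')) -fmorM uv' fmor1 comp1l uv.
Qed.

Lemma linear_equivalence_trans k (C D E : lincat k) :
  linear_equivalence C D -> linear_equivalence D E -> linear_equivalence C E.
Proof.
move=> /linear_equivalence_weak[F eF] /linear_equivalence_weak[G eG].
exact: (weak_equiv_linear_equivalence (weak_equiv_comp eF eG)).
Qed.

Section AbelianTransport.
Variables (k : fieldType) (C D : lincat k) (F : linfunctor C D).
Hypothesis F_equiv : weak_equiv F.

Let Ffaith : faithful F. Proof. by case: F_equiv. Qed.
Let Ffull : full F. Proof. by case: F_equiv. Qed.
Let Fess : ess_surj F. Proof. by case: F_equiv. Qed.

(** As [F] is full and faithful, the universal property of a kernel of [f] can be
    tested on images under [F]; the isomorphism [u] is there because the source of
    a kernel of [F f] is only isomorphic to an object [F K]. *)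
Lemma kernel_reflect X Y (f : hom X Y) K' (i' : hom K' (F X)) K
    (u : hom (F K) K') (v : hom K' (F K)) (i : hom K X) :
  is_kernel (fmor F f) i' -> v \oc u = idm _ -> u \oc v = idm _ ->
  fmor F i = i' \oc u -> is_kernel f i.
Proof.
move=> [fi0 ker_i] vu uv Fi; split.
  by apply: Ffaith; rewrite fmorM Fi compA fi0 comp0l fmor0.
move=> Z g fg0; have [|h [ih uniq_h]] := ker_i _ (fmor F g).
  by rewrite -fmorM fg0 fmor0.
have [h1 Fh1] := Ffull (v \oc h); exists h1; split.
  by apply: Ffaith; rewrite fmorM Fi Fh1 -compA (compA u) uv comp1l.
move=> h2 ih2; apply: Ffaith; rewrite Fh1 (uniq_h (u \oc fmor F h2)).
  by rewrite compA vu comp1l.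
by rewrite compA -Fi -fmorM ih2.
Qed.

Lemma cokernel_reflect X Y (f : hom X Y) Q' (q' : hom (F Y) Q') Q
    (u : hom (F Q) Q') (v : hom Q' (F Q)) (q : hom Y Q) :
  is_cokernel (fmor F f) q' -> v \oc u = idm _ -> u \oc v = idm _ ->
  fmor F q = v \oc q' -> is_cokernel f q.
Proof.
move=> [qf0 coker_q] vu uv Fq; split.
  by apply: Ffaith; rewrite fmorM Fq -compA qf0 comp0r fmor0.
move=> Z g gf0; have [|h [hq uniq_h]] := coker_q _ (fmor F g).
  by rewrite -fmorM gf0 fmor0.
have [h1 Fh1] := Ffull (h \oc u); exists h1; split.
  by apply: Ffaith; rewrite fmorM Fq Fh1 -compA (compA u) uv comp1l.
move=> h2 h2q; apply: Ffaith; rewrite Fh1 (uniq_h (fmor F h2 \oc v)).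
  by rewrite -compA vu comp1r.
by rewrite -compA -Fq -fmorM h2q.
Qed.

(** The objects that D provides are replaced by isomorphic ones in the image of
    [F], and the morphisms by their preimages. *)
Lemma weak_equiv_abelian : is_abelian D -> is_abelian C.
Proof.
move=> [[[Z' [toZ fromZ]] biprod] kers cokers monos epis]; split.
- split.
    have [Z [u [v [vu uv]]]] := Fess Z'; exists Z.
    split=> X f; apply: Ffaith; rewrite fmor0.
      by rewrite -[fmor F f]comp1l -vu -compA (toZ _ (u \oc _)) comp0r.
    by rewrite -[fmor F f]comp1r -vu compA (fromZ _ (_ \oc v)) comp0l.
  move=> X Y; have [S' [i [j [p [q [pi qj pj qi ipjq]]]]]] := biprod (F X) (F Y).
  have [S [u [v [vu uv]]]] := Fess S'; exists S.
  have [i1 Fi] := Ffull (v \oc i); have [j1 Fj] := Ffull (v \oc j).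
  have [p1 Fp] := Ffull (p \oc u); have [q1 Fq] := Ffull (q \oc u).
  have cancel_uv A B (a : hom S' A) (b : hom B S') :
    (a \oc u) \oc (v \oc b) = a \oc b by rewrite -compA (compA u) uv comp1l.
  exists i1, j1, p1, q1; split; apply: Ffaith;
    rewrite ?fmorM ?fmor1 ?fmor0 ?Fi ?Fj ?Fp ?Fq ?cancel_uv //.
  rewrite (klinearD (@fmor_lin _ _ _ F _ _)) !fmorM Fi Fj Fp Fq.
  rewrite -!compA -(klinearD (comp_linr v)) !compA.
  by rewrite -(klinearD (comp_linl u)) ipjq comp1l vu.
- move=> X Y f; have [K' [i' ker_i]] := kers _ _ (fmor F f).
  have [K [u [v [vu uv]]]] := Fess K'; have [i Fi] := Ffull (i' \oc u).
  by exists K, i; apply: (kernel_reflect ker_i vu uv Fi).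
- move=> X Y f; have [Q' [q' coker_q]] := cokers _ _ (fmor F f).
  have [Q [u [v [vu uv]]]] := Fess Q'; have [q Fq] := Ffull (v \oc q').
  by exists Q, q; apply: (cokernel_reflect coker_q vu uv Fq).
- move=> X Y f mono_f.
  have mono_Ff : is_mono (fmor F f).
    move=> Z1 g h efgh; have [Z [u [v [vu uv]]]] := Fess Z1.
    have [g1 Fg] := Ffull (g \oc u); have [h1 Fh] := Ffull (h \oc u).
    have egh1 : g1 = h1.
      by apply: mono_f; apply: Ffaith; rewrite !fmorM Fg Fh !compA efgh.
    by rewrite -[g]comp1r -uv compA -Fg egh1 Fh -compA uv comp1r.
  have [Z1 [g' [gf0 ker_f]]] := monos _ _ _ mono_Ff.
  have [Z [u [v [vu uv]]]] := Fess Z1; have [g Fg] := Ffull (v \oc g').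
  have kerF : is_kernel (fmor F g) (fmor F f).
    split=> [|T h]; first by rewrite Fg -compA gf0 comp0r.
    move=> gh0; apply: ker_f.
    by rewrite -[g']comp1l -uv -[u \oc _ \oc _]compA -Fg -compA gh0 comp0r.
  exists Z, g; apply: (kernel_reflect kerF (comp1l (idm _)) (comp1l (idm _))).
  by rewrite comp1r.
move=> X Y f epi_f.
have epi_Ff : is_epi (fmor F f).
  move=> Z1 g h efgh; have [Z [u [v [vu uv]]]] := Fess Z1.
  have [g1 Fg] := Ffull (v \oc g); have [h1 Fh] := Ffull (v \oc h).
  have egh1 : g1 = h1.
    by apply: epi_f; apply: Ffaith; rewrite !fmorM Fg Fh -!compA efgh.
  by rewrite -[g]comp1l -uv -compA -Fg egh1 Fh compA uv comp1l.
have [Z1 [g' [fg0 coker_f]]] := epis _ _ _ epi_Ff.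
have [Z [u [v [vu uv]]]] := Fess Z1; have [g Fg] := Ffull (g' \oc u).
have cokerF : is_cokernel (fmor F g) (fmor F f).
  split=> [|T h]; first by rewrite Fg compA fg0 comp0l.
  move=> hg0; apply: coker_f.
  by rewrite -[g']comp1r -uv (compA g') -Fg compA hg0 comp0l.
exists Z, g; apply: (cokernel_reflect cokerF (comp1l (idm _)) (comp1l (idm _))).
by rewrite comp1l.
Qed.

End AbelianTransport.

Lemma linear_equivalence_abelian k (C D : lincat k) :
  is_abelian C -> linear_equivalence C D -> abelian_equivalence C D.
Proof.
move=> abC eCD; split=> //.
have [F eF] := linear_equivalence_weak (linear_equivalence_sym eCD).
exact: (weak_equiv_abelian eF).
Qed.

(** * Functors to vector spaces form an abelian category *)

Section SplitLinearAlgebra.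
Variable k : fieldType.
Implicit Types U V W : vectType k.

Lemma idempotent_splits V (e : 'End(V)) : (e \o e)%VF = e ->
  exists (K : vectType k) (i : 'Hom(K, V)) (r : 'Hom(V, K)),
    (r \o i)%VF = \1%VF /\ (i \o r)%VF = e.
Proof.
move=> ee; exists (subvs_of (limg e)), (linfun vsval).
exists (linfun (vsproj (limg e)) \o e)%VF; split; apply/lfunP => x.
  rewrite !comp_lfunE id_lfunE !lfunE /=; apply: val_inj => /=.
  have /memv_imgP[y _ ->] := subvsP x.
  by rewrite -comp_lfunE ee vsprojK ?memv_img ?memvf.
by rewrite !comp_lfunE !lfunE /= vsprojK // memv_img ?memvf.
Qed.

Lemma idempotent_compl V (e : 'End(V)) : (e \o e)%VF = e ->
  ((\1%VF - e) \o (\1%VF - e))%VF = \1%VF - e.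
Proof.
move=> ee; rewrite comp_lfunDl comp_lfun1l comp_lfunNl comp_lfunDr comp_lfun1r.
by rewrite comp_lfunNr ee subrr oppr0 addr0.
Qed.

Lemma quasi_invertible V W (f : 'Hom(V, W)) : (f \o f^-1 \o f)%VF = f.
Proof.
by apply/lfunP => x; rewrite !comp_lfunE limg_lfunVK // memv_img ?memvf.
Qed.

(** All that is used of the kernel of [f]: [ker_lift] is its universal property,
    [ker_quasi] the factorization through [f] of the maps that vanish on it.  The
    factorizations are explicit, through the retraction [ker_re] and the
    generalized inverse [f^-1], so as to form natural families. *)
Record split_ker V W (f : 'Hom(V, W)) := SplitKer {
  ker_obj : vectType k;
  ker_in : 'Hom(ker_obj, V);
  ker_re : 'Hom(V, ker_obj);
  ker_comp : (f \o ker_in = 0)%VF;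
  ker_inK : (ker_re \o ker_in = \1)%VF;
  ker_lift : forall U (g : 'Hom(U, V)), (f \o g = 0)%VF ->
    (ker_in \o (ker_re \o g) = g)%VF;
  ker_quasi : forall U (g : 'Hom(V, U)), (g \o ker_in = 0)%VF ->
    (g \o f^-1 \o f = g)%VF }.

Record split_coker V W (f : 'Hom(V, W)) := SplitCoker {
  coker_obj : vectType k;
  coker_pr : 'Hom(W, coker_obj);
  coker_se : 'Hom(coker_obj, W);
  coker_comp : (coker_pr \o f = 0)%VF;
  coker_prK : (coker_pr \o coker_se = \1)%VF;
  coker_colift : forall U (g : 'Hom(W, U)), (g \o f = 0)%VF ->
    (g \o coker_se \o coker_pr = g)%VF;
  coker_quasi : forall U (g : 'Hom(U, W)), (coker_pr \o g = 0)%VF ->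
    (f \o (f^-1 \o g) = g)%VF }.

(** The idempotent \1 - f^-1 f projects onto the kernel of [f]. *)
Lemma split_kernel V W (f : 'Hom(V, W)) : split_ker f.
Proof.
have [|K /cid[i /cid[r [ri ir]]]] :=
    cid (@idempotent_splits V (\1%VF - (f^-1 \o f)%VF) _).
  by apply: idempotent_compl; rewrite -comp_lfunA (comp_lfunA f) quasi_invertible.
exists K i r => // [|U g fg0 | U g gi0].
- rewrite -[i]comp_lfun1r -ri (comp_lfunA i) ir comp_lfunA.
  rewrite comp_lfunDr comp_lfun1r comp_lfunNr comp_lfunA quasi_invertible subrr.
  by rewrite comp_lfun0l.
- by rewrite comp_lfunA ir comp_lfunDl comp_lfun1l comp_lfunNl -comp_lfunA fg0
    comp_lfun0r subr0.
apply/esym/eqP; rewrite -subr_eq0 -comp_lfunA -[X in X - _]comp_lfun1r.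
by rewrite -comp_lfunNr -comp_lfunDr -ir comp_lfunA gi0 comp_lfun0l.
Qed.

(** The idempotent \1 - f f^-1 projects onto a complement of the image of [f]. *)
Lemma split_cokernel V W (f : 'Hom(V, W)) : split_coker f.
Proof.
have [|Q /cid[s /cid[q [qs sq]]]] :=
    cid (@idempotent_splits W (\1%VF - (f \o f^-1)%VF) _).
  by apply: idempotent_compl; rewrite comp_lfunA quasi_invertible.
exists Q q s => // [|U g gf0 | U g qg0].
- rewrite -[q]comp_lfun1l -qs -(comp_lfunA q) sq -comp_lfunA.
  by rewrite comp_lfunDl comp_lfun1l comp_lfunNl quasi_invertible subrr comp_lfun0r.
- by rewrite -comp_lfunA sq comp_lfunDr comp_lfun1r comp_lfunNr comp_lfunA gf0
    comp_lfun0l subr0.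
apply/esym/eqP; rewrite -subr_eq0 comp_lfunA -[X in X - _]comp_lfun1l.
by rewrite -comp_lfunNl -comp_lfunDl -sq -comp_lfunA qg0 comp_lfun0r.
Qed.

Definition pair_inl V W (v : V) : V * W := (v, 0).
Definition pair_inr V W (w : W) : V * W := (0, w).

Fact pair_inl_linear V W : linear (@pair_inl V W).
Proof. by move=> a u v; apply: injective_projections; rewrite //= scaler0 addr0. Qed.
Fact pair_inr_linear V W : linear (@pair_inr V W).
Proof. by move=> a u v; apply: injective_projections; rewrite //= scaler0 addr0. Qed.

HB.instance Definition _ V W :=
  GRing.isLinear.Build k V (V * W)%type _ (@pair_inl V W) (@pair_inl_linear V W).
HB.instance Definition _ V W :=
  GRing.isLinear.Build k W (V * W)%type _ (@pair_inr V W) (@pair_inr_linear V W).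

End SplitLinearAlgebra.

Lemma retraction_cancel k (D : lincat k) (X Y Z : D) (i : hom Y Z) (r : hom Z Y)
  (g h : hom X Y) : r \oc i = idm Y -> i \oc g = i \oc h -> g = h.
Proof. by move=> ri /(congr1 (comp r)); rewrite !compA ri !comp1l. Qed.

Lemma section_cancel k (D : lincat k) (X Y Z : D) (q : hom X Y) (s : hom Y X)
  (g h : hom Y Z) : q \oc s = idm Y -> g \oc q = h \oc q -> g = h.
Proof.
by move=> qs /(congr1 (fun f => comp f s)); rewrite -!compA qs !comp1r.
Qed.

Section FunctorKernels.
Variables (k : fieldType) (C : lincat k).
Local Notation vhom := (@hom k (vect_cat k)).
Local Notation vidm := (@idm k (vect_cat k)).
Local Notation FC := (functor_cat C (vect_cat k)).
Implicit Types F G H : linfunctor C (vect_cat k).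

Lemma functor_zero : exists Z : FC, is_zero_obj Z.
Proof.
pose O : vectType k := 'rV[k]_0.
have O0 (U : vectType k) (f : 'Hom(U, O)) : f = 0.
  by apply/lfunP => x; rewrite lfunE; apply/rowP; case.
have O0' (U : vectType k) (f : 'Hom(O, U)) : f = 0.
  by rewrite -[f]comp_lfun1r (O0 _ \1%VF) comp_lfun0r.
have Olin (X Y : C) : klinear (fun _ : hom X Y => kzero : vhom O O).
  by move=> a f g /=; rewrite scaler0 addr0.
pose Z := @LinFunctor _ C (vect_cat k) (fun=> O) (fun _ _ _ => kzero)
  Olin (fun=> esym (O0 _ _)) (fun _ _ _ _ _ => esym (O0 _ _)).
by exists Z; split=> F f; apply: nat_transP => X; [apply: O0 | apply: O0'].
Qed.

Lemma functor_biproduct (F G : FC) : exists (S : FC) (i : hom F S) (j : hom G S)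
  (p : hom S F) (q : hom S G), is_biproduct i j p q.
Proof.
pose S (X : C) : vectType k := (F X * G X)%type.
pose i X : 'Hom(F X, S X) := linfun (@pair_inl _ (F X) (G X)).
pose j X : 'Hom(G X, S X) := linfun (@pair_inr _ (F X) (G X)).
pose p X : 'Hom(S X, F X) := linfun fst.
pose q X : 'Hom(S X, G X) := linfun snd.
have pi X : (p X \o i X = \1)%VF.
  by apply/lfunP => x; rewrite comp_lfunE !lfunE.
have qj X : (q X \o j X = \1)%VF.
  by apply/lfunP => x; rewrite comp_lfunE !lfunE.
have pj X : (p X \o j X = 0)%VF.
  by apply/lfunP => x; rewrite comp_lfunE !lfunE.
have qi X : (q X \o i X = 0)%VF.
  by apply/lfunP => x; rewrite comp_lfunE !lfunE.
have ipjq X : (i X \o p X)%VF + (j X \o q X)%VF = \1%VF.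
  apply/lfunP => x; rewrite add_lfunE !comp_lfunE !lfunE /=.
  by apply: injective_projections; rewrite /= (addr0, add0r).
pose Smor X Y (f : hom X Y) : 'Hom(S X, S Y) :=
  (i Y \o (fmor F f \o p X))%VF + (j Y \o (fmor G f \o q X))%VF.
have Smor_i X Y (f : hom X Y) : (Smor X Y f \o i X = i Y \o fmor F f)%VF.
  rewrite comp_lfunDl -!comp_lfunA pi qi !comp_lfun0r addr0.
  by rewrite comp_lfun1r.
have Smor_j X Y (f : hom X Y) : (Smor X Y f \o j X = j Y \o fmor G f)%VF.
  rewrite comp_lfunDl -!comp_lfunA pj qj !comp_lfun0r add0r.
  by rewrite comp_lfun1r.
have Smor_p X Y (f : hom X Y) : (p Y \o Smor X Y f = fmor F f \o p X)%VF.
  by rewrite comp_lfunDr !comp_lfunA pi pj !comp_lfun0l addr0 comp_lfun1l.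
have Smor_q X Y (f : hom X Y) : (q Y \o Smor X Y f = fmor G f \o q X)%VF.
  by rewrite comp_lfunDr !comp_lfunA qi qj !comp_lfun0l add0r comp_lfun1l.
have Smor_lin X Y : klinear (V := lfun_kmod _ _) (@Smor X Y).
  move=> a f g; rewrite /Smor !fmor_lin /=.
  by rewrite !comp_lfunDl !comp_lfunDr -!comp_lfunZl -!comp_lfunZr scalerDr addrACA.
have Smor1 X : Smor X X (idm X) = \1%VF.
  by rewrite /Smor !fmor1 /= !comp_lfun1l ipjq.
have SmorM X Y Z (g : hom Y Z) (f : hom X Y) :
    Smor X Z (g \oc f) = (Smor Y Z g \o Smor X Y f)%VF.
  rewrite {2}/Smor comp_lfunDr !(comp_lfunA (Smor Y Z g)) Smor_i Smor_j.
  by rewrite /Smor !fmorM /= !comp_lfunA.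
pose SF := @LinFunctor _ C (vect_cat k) S Smor Smor_lin Smor1 SmorM.
have i_nat : natural (F := F) (G := SF) i by move=> X Y f; apply/esym/Smor_i.
have j_nat : natural (F := G) (G := SF) j by move=> X Y f; apply/esym/Smor_j.
have p_nat : natural (G := F) (F := SF) p by move=> X Y f; apply/Smor_p.
have q_nat : natural (G := G) (F := SF) q by move=> X Y f; apply/Smor_q.
exists SF, (exist _ i i_nat), (exist _ j j_nat), (exist _ p p_nat).
exists (exist _ q q_nat).
by split; apply: nat_transP => X; [apply: pi | apply: qj | apply: pj
  | apply: qi | apply: ipjq].
Qed.

(** A natural transformation factors through [i] as soon as it does so
    objectwise, because [i] is objectwise a split monomorphism. *)
Lemma natural_lift (H K F : linfunctor C (vect_cat k)) (i : nat_trans K F)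
    (r : forall X, hom (F X) (K X)) (b : nat_trans H F) :
    (forall X, r X \oc sval i X = idm (K X)) ->
    (forall X, sval i X \oc (r X \oc sval b X) = sval b X) ->
  exists! h : nat_trans H K, nt_comp i h = b.
Proof.
move=> ri irb.
have h_nat : natural (F := H) (G := K) (fun X => r X \oc sval b X).
  move=> X Y f; apply: (retraction_cancel (ri Y)).
  rewrite [LHS]compA irb [RHS]compA (svalP i) -compA irb.
  exact: svalP b _ _ f.
exists (exist _ _ h_nat); split; first by apply: nat_transP => X; apply: irb.
move=> h' ih'; apply: nat_transP => X /=; apply: (retraction_cancel (ri X)).
by rewrite irb -ih'.
Qed.

Lemma natural_colift (H Q G : linfunctor C (vect_cat k)) (q : nat_trans G Q)
    (s : forall X, hom (Q X) (G X)) (b : nat_trans G H) :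
    (forall X, sval q X \oc s X = idm (Q X)) ->
    (forall X, (sval b X \oc s X) \oc sval q X = sval b X) ->
  exists! h : nat_trans Q H, nt_comp h q = b.
Proof.
move=> qs bsq.
have h_nat : natural (F := Q) (G := H) (fun X => sval b X \oc s X).
  move=> X Y f; apply: (section_cancel (qs X)).
  rewrite -[LHS]compA -(svalP q) compA bsq -[RHS]compA bsq.
  exact: svalP b _ _ f.
exists (exist _ _ h_nat); split; first by apply: nat_transP => X; apply: bsq.
move=> h' h'q; apply: nat_transP => X /=; apply: (section_cancel (qs X)).
by rewrite bsq -h'q.
Qed.

(** The retractions make the objectwise kernels functorial: the map that
    [fmor F f] induces between them is its conjugate r_Y (F f) i_X. *)
Lemma functor_kernel F G (a : nat_trans F G) :
  exists (K : linfunctor C (vect_cat k)) (i : nat_trans K F)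
      (r : forall X, hom (F X) (K X)),
    [/\ nt_comp a i = kzero, forall X, r X \oc sval i X = idm (K X),
        forall X (U : vectType k) (g : 'Hom(U, F X)),
          (sval a X \o g = 0)%VF -> (sval i X \o (r X \o g))%VF = g
      & forall X (U : vectType k) (g : 'Hom(F X, U)), (g \o sval i X = 0)%VF ->
          (g \o (sval a X)^-1 \o (sval a X))%VF = g].
Proof.
pose A (X : C) := split_kernel (sval a X).
pose K X := ker_obj (A X).
pose i X : vhom (K X) (F X) := ker_in (A X).
pose r X : vhom (F X) (K X) := ker_re (A X).
have ai X : sval a X \oc i X = kzero := ker_comp (A X).
have ri X : r X \oc i X = vidm (K X) := ker_inK (A X).
have irP X (U : vectType k) (g : vhom U (F X)) :
  sval a X \oc g = kzero -> i X \oc (r X \oc g) = g := @ker_lift _ _ _ _ (A X) U g.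
pose Kmor X Y (f : hom X Y) : vhom (K X) (K Y) := r Y \oc (fmor F f \oc i X).
have iK X Y (f : hom X Y) : i Y \oc Kmor X Y f = fmor F f \oc i X.
  by rewrite irP // compA (svalP a) -compA ai comp0r.
have Kmor_lin X Y : klinear (@Kmor X Y).
  by move=> c f g; rewrite /Kmor fmor_lin comp_linl comp_linr.
have Kmor1 X : Kmor X X (idm X) = vidm (K X).
  by rewrite /Kmor fmor1 comp1l ri.
have KmorM X Y Z (g : hom Y Z) (f : hom X Y) :
    Kmor X Z (g \oc f) = Kmor Y Z g \oc Kmor X Y f.
  by apply: (retraction_cancel (ri Z)); rewrite iK fmorM compA iK -!compA iK.
pose Kf := @LinFunctor _ C (vect_cat k) K Kmor Kmor_lin Kmor1 KmorM.
have i_nat : natural (F := Kf) (G := F) i by move=> X Y f; apply: iK.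
exists Kf, (exist _ i i_nat), r; split=> //.
  by apply: nat_transP => X; apply: ai.
by move=> X U g; apply: (ker_quasi (g:=g)).
Qed.

Lemma functor_cokernel F G (a : nat_trans F G) :
  exists (Q : linfunctor C (vect_cat k)) (q : nat_trans G Q)
      (s : forall X, hom (Q X) (G X)),
    [/\ nt_comp q a = kzero, forall X, sval q X \oc s X = idm (Q X),
        forall X (U : vectType k) (g : 'Hom(G X, U)),
          (g \o sval a X = 0)%VF -> (g \o s X \o sval q X)%VF = g
      & forall X (U : vectType k) (g : 'Hom(U, G X)), (sval q X \o g = 0)%VF ->
          (sval a X \o ((sval a X)^-1 \o g))%VF = g].
Proof.
pose A (X : C) := split_cokernel (sval a X).
pose Q X := coker_obj (A X).
pose q X : vhom (G X) (Q X) := coker_pr (A X).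
pose s X : vhom (Q X) (G X) := coker_se (A X).
have qa X : q X \oc sval a X = kzero := coker_comp (A X).
have qs X : q X \oc s X = vidm (Q X) := coker_prK (A X).
have sqP X (U : vectType k) (g : vhom (G X) U) :
  g \oc sval a X = kzero -> g \oc s X \oc q X = g := @coker_colift _ _ _ _ (A X) U g.
pose Qmor X Y (f : hom X Y) : vhom (Q X) (Q Y) := q Y \oc fmor G f \oc s X.
have Qq X Y (f : hom X Y) : Qmor X Y f \oc q X = q Y \oc fmor G f.
  by rewrite sqP // -compA -(svalP a) compA qa comp0l.
have Qmor_lin X Y : klinear (@Qmor X Y).
  by move=> c f g; rewrite /Qmor fmor_lin comp_linr comp_linl.
have Qmor1 X : Qmor X X (idm X) = vidm (Q X).
  by rewrite /Qmor fmor1 comp1r qs.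
have QmorM X Y Z (g : hom Y Z) (f : hom X Y) :
    Qmor X Z (g \oc f) = Qmor Y Z g \oc Qmor X Y f.
  by apply: (section_cancel (qs X)); rewrite Qq fmorM -[RHS]compA Qq !compA Qq.
pose Qf := @LinFunctor _ C (vect_cat k) Q Qmor Qmor_lin Qmor1 QmorM.
have q_nat : natural (F := G) (G := Qf) q by move=> X Y f; apply/esym/Qq.
exists Qf, (exist _ q q_nat), s; split=> //.
  by apply: nat_transP => X; apply: qa.
by move=> X U g; apply: (coker_quasi (g:=g)).
Qed.

(** A monomorphism of functors has an objectwise zero kernel, hence is objectwise
    a split injection, and is then the kernel of its cokernel; dually for
    epimorphisms. *)
Lemma functor_cat_abelian : is_abelian FC.
Proof.
split.
- by split; [apply: functor_zero | apply: functor_biproduct].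
- move=> F G a; have [K [i [r [ai ri irP _]]]] := functor_kernel a.
  exists K, i; split=> // H b ab0.
  apply: (natural_lift ri) => X; apply: irP.
  by have /(congr1 (fun c => sval c X)) := ab0.
- move=> F G a; have [Q [q [s [qa qs sqP _]]]] := functor_cokernel a.
  exists Q, q; split=> // H b ba0.
  apply: (natural_colift qs) => X; apply: sqP.
  by have /(congr1 (fun c => sval c X)) := ba0.
- move=> F G a mono_a; have [K [i [r [ai ri _ tP]]]] := functor_kernel a.
  have [Q [q [s [qa _ _ atP]]]] := functor_cokernel a.
  have i0 : i = kzero by apply: mono_a; rewrite comp0r -ai.
  pose t X : vhom (G X) (F X) := (sval a X)^-1%VF.
  have ta X : t X \oc sval a X = vidm (F X).
    rewrite -[LHS]comp1l compA; apply: (tP X _ (vidm (F X))).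
    by rewrite i0; apply: comp_lfun0r.
  exists Q, q; split=> // H b qb0.
  apply: (natural_lift ta) => X; apply: atP.
  by have /(congr1 (fun c => sval c X)) := qb0.
move=> F G a epi_a; have [Q [q [s [qa qs _ atP]]]] := functor_cokernel a.
have [K [i [r [ai _ _ tP]]]] := functor_kernel a.
have q0 : q = kzero by apply: epi_a; rewrite comp0l -qa.
pose t X : vhom (G X) (F X) := (sval a X)^-1%VF.
have at1 X : sval a X \oc t X = vidm (G X).
  rewrite -[LHS]comp1r -compA; apply: (atP X _ (vidm (G X))).
  by rewrite q0; apply: comp_lfun0l.
exists K, i; split=> // H b bi0.
apply: (natural_colift at1) => X; apply: tP.
by have /(congr1 (fun c => sval c X)) := bi0.
Qed.

End FunctorKernels.

(** * Evaluation at a generator *)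

Local Notation ksum F := (\big[kadd/kzero]_i F i).

Lemma klinear_sum k (U V : kmod k) (f : U -> V) (I : finType) (u : I -> U) :
  klinear f -> f (ksum u) = \big[kadd/kzero]_i f (u i).
Proof.
by move=> f_lin; apply: big_morph; [apply: klinearD | apply: klinear0].
Qed.

Lemma comp_lfun_suml (k : fieldType) (U V W : vectType k) (I : finType)
    (f : I -> 'Hom(V, W)) (g : 'Hom(U, V)) :
  ((\sum_i f i) \o g = \sum_i (f i \o g))%VF.
Proof.
by apply: (big_morph (fun h => (h \o g)%VF)) => [h h'|];
  rewrite (comp_lfunDl, comp_lfun0l).
Qed.

Lemma comp_lfun_sumr (k : fieldType) (U V W : vectType k) (I : finType)
    (f : I -> 'Hom(U, V)) (g : 'Hom(V, W)) :
  (g \o (\sum_i f i) = \sum_i (g \o f i))%VF.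
Proof.
by apply: (big_morph (fun h => (g \o h)%VF)) => [h h'|];
  rewrite (comp_lfunDr, comp_lfun0r).
Qed.

(** [X] is a direct summand of a finite direct sum of copies of [X0].  Recording
    only the components of the inclusion and of the projection avoids direct sums,
    which the category may lack. *)
Record generated k (C : lincat k) (X0 X : C) := Generated {
  gen_index : finType;
  gen_to : gen_index -> hom X X0;
  gen_from : gen_index -> hom X0 X;
  gen_sum : \big[kadd/kzero]_i (gen_from i \oc gen_to i) = idm X }.

(** An isomorphism of algebras from S(n,d) to End(X0); the latter is not an
    algebra as a type, only a module with a composition. *)
Record schur_point k n d (C : lincat k) (X0 : C) := SchurPoint {
  spt : schur_alg k n d -> hom X0 X0;
  spt_inv : hom X0 X0 -> schur_alg k n d;
  spt_lin : forall a s t, spt (a *: s + t) = kadd (kscale a (spt s)) (spt t);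
  spt1 : spt 1 = idm X0;
  sptM : forall s t, spt (s * t) = spt s \oc spt t;
  sptK : cancel spt spt_inv;
  spt_invK : cancel spt_inv spt }.

Section Evaluation.
Variables (k : fieldType) (n d : nat) (C : lincat k) (X0 : C).
Variable phi : schur_point n d X0.
Local Notation vhom := (@hom k (vect_cat k)).

Section Action.
Variable F : linfunctor C (vect_cat k).

Definition ev_act (s : schur_alg k n d) : 'End(F X0) := fmor F (spt phi s).

Fact ev_act_linear : linear ev_act.
Proof. by move=> a s t; rewrite /ev_act spt_lin fmor_lin. Qed.
HB.instance Definition _ :=
  GRing.isLinear.Build k (schur_alg k n d) 'End(F X0) _ ev_act ev_act_linear.

Fact ev_act1 : ev_act 1 = \1%VF.
Proof. by rewrite /ev_act spt1 fmor1. Qed.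

Fact ev_actM s t : ev_act (s * t) = (ev_act s \o ev_act t)%VF.
Proof. by rewrite /ev_act sptM fmorM. Qed.

Definition ev_obj : schur_mod k n d := SchurModule ev_act1 ev_actM.

End Action.

Fact ev_mor_subproof F G (a : nat_trans F G) :
  schur_submod (ev_obj F) (ev_obj G) (sval a X0).
Proof. by move=> s; apply: (svalP a). Qed.

Definition ev_mor (F G : functor_cat C (vect_cat k)) (a : hom F G) :
  hom (ev_obj F) (ev_obj G) := exist _ _ (ev_mor_subproof a).

Fact ev_mor_lin F G : klinear (@ev_mor F G).
Proof. by move=> c a b; apply: ksub_inj. Qed.

Definition evaluation : linfunctor (functor_cat C (vect_cat k)) (schur_mod k n d).
Proof.
by refine (LinFunctor ev_mor_lin _ _) => *; apply: ksub_inj.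
Defined.

Hypothesis X0_gen : forall X, generated X0 X.

Local Notation I := (fun X => gen_index (X0_gen X)).
Local Notation "'f_[' X ] i" := (@gen_to _ _ _ _ (X0_gen X) i)
  (at level 10, X at level 200, i at level 8).
Local Notation "'g_[' X ] i" := (@gen_from _ _ _ _ (X0_gen X) i)
  (at level 10, X at level 200, i at level 8).

Lemma gen_fmor (F : linfunctor C (vect_cat k)) X :
  \sum_i (fmor F (g_[X] i) \o fmor F (f_[X] i))%VF = \1%VF :> 'End(F X).
Proof.
rewrite -[RHS](fmor1 F X) -(gen_sum (X0_gen X)).
rewrite (klinear_sum _ (@fmor_lin _ _ _ F X X)).
by apply: eq_bigr => i _; rewrite fmorM.
Qed.

Lemma evaluation_faithful : faithful evaluation.
Proof.
move=> F G a b /(congr1 (fun c => sval c)) /= eab; apply: (@nat_transP _ _ _ F G a b) => X.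
rewrite -[sval a X]comp_lfun1r -[sval b X]comp_lfun1r -(gen_fmor F X).
rewrite !comp_lfun_sumr; apply: eq_bigr => i _; rewrite !comp_lfunA.
have nat_c (c : nat_trans F G) :
    (sval c X \o fmor F (g_[X] i) = fmor G (g_[X] i) \o sval c X0)%VF.
  exact: (svalP c).
by rewrite !nat_c eab.
Qed.

(** Naturality leaves no choice for the extension of [u : F X0 -> G X0] to other
    objects: composing with the decomposition of the identity of X shows that its
    component at X is the sum of the G(g_i) u F(f_i). *)
Lemma evaluation_full : full evaluation.
Proof.
move=> F G [u u_eq].
have u_end (h : hom X0 X0) : (u \o fmor F h = fmor G h \o u)%VF.
  by have := u_eq (spt_inv phi h); rewrite /= /ev_act spt_invK.
pose a X : vhom (F X) (G X) :=
  \sum_i (fmor G (g_[X] i) \o u \o fmor F (f_[X] i))%VF.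
have a_nat : natural (F := F) (G := G) a.
  move=> X Y h.
  have -> : a Y \oc fmor F h = \sum_j \sum_i
    (fmor G (g_[Y] j) \o u \o (fmor F (f_[Y] j) \o fmor F h \o
       fmor F (g_[X] i)) \o fmor F (f_[X] i))%VF.
    rewrite /a /= comp_lfun_suml; apply: eq_bigr => j _.
    rewrite -[LHS]comp_lfun1r -(gen_fmor F X) comp_lfun_sumr.
    by apply: eq_bigr => i _; rewrite !comp_lfunA.
  have -> : fmor G h \oc a X = \sum_j \sum_i
    (fmor G (g_[Y] j) \o ((fmor G (f_[Y] j) \o fmor G h \o
       fmor G (g_[X] i)) \o u) \o fmor F (f_[X] i))%VF.
    rewrite -[LHS]comp_lfun1l -(gen_fmor G Y) comp_lfun_suml.
    apply: eq_bigr => j _; rewrite /a /= !comp_lfun_sumr.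
    by apply: eq_bigr => i _; rewrite !comp_lfunA.
  apply: eq_bigr => j _; apply: eq_bigr => i _; congr (_ \o _)%VF.
  rewrite -comp_lfunA; congr (_ \o _)%VF.
  by have := u_end (f_[Y] j \oc h \oc g_[X] i); rewrite !fmorM /= => ->.
exists (exist _ a a_nat); apply: ksub_inj => /=; rewrite /a.
rewrite -[u in RHS]comp_lfun1l -(gen_fmor G X0) comp_lfun_suml.
by apply: eq_bigr => i _; rewrite -!comp_lfunA u_end.
Qed.

Section Extension.
Variable M : schur_module k n d.

Definition mact (h : hom X0 X0) : 'End(M) := smod_act M (spt_inv phi h).

Lemma mactE s : mact (spt phi s) = smod_act M s.
Proof. by rewrite /mact sptK. Qed.

Lemma mact1 : mact (idm X0) = \1%VF.
Proof. by rewrite -(spt1 phi) mactE smod_act1. Qed.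

Lemma mactM h h' : mact (h \oc h') = (mact h \o mact h')%VF.
Proof.
rewrite -[h in LHS](spt_invK phi) -[h' in LHS](spt_invK phi) -sptM mactE.
exact: smod_actM.
Qed.

Lemma mact_lin : klinear (V := lfun_kmod M M) mact.
Proof.
move=> a h h'; rewrite -[h in LHS](spt_invK phi) -[h' in LHS](spt_invK phi).
by rewrite -spt_lin mactE linearP.
Qed.

Lemma mact_gen X (h : hom X X0) (h' : hom X0 X) :
  \sum_i (mact (h \oc g_[X] i) \o mact (f_[X] i \oc h'))%VF = mact (h \oc h').
Proof.
rewrite -[h in RHS]comp1r -(gen_sum (X0_gen X)).
rewrite (klinear_sum _ (comp_linr _)) (klinear_sum _ (comp_linl _)).
rewrite (klinear_sum _ mact_lin); apply: eq_bigr => i _.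
by rewrite -mactM !compA.
Qed.

(** A morphism [h] from X to Y is turned into the matrix of its components
    f_j h g_i, which are endomorphisms of X0 and hence act on M. *)
Definition ext_mx_fun X Y (h : hom X Y) (x : {ffun I X -> M}) : {ffun I Y -> M} :=
  [ffun j => \sum_i mact (f_[Y] j \oc h \oc g_[X] i) (x i)].

Fact ext_mx_linear X Y (h : hom X Y) : linear (ext_mx_fun h).
Proof.
move=> a x y; apply/ffunP => j; rewrite !ffunE scaler_sumr -big_split /=.
by apply: eq_bigr => i _; rewrite !ffunE linearP.
Qed.
HB.instance Definition _ X Y (h : hom X Y) :=
  GRing.isLinear.Build k {ffun I X -> M} {ffun I Y -> M} _ (ext_mx_fun h)
    (ext_mx_linear h).

Definition ext_mx X Y (h : hom X Y) : 'Hom({ffun I X -> M}, {ffun I Y -> M}) :=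
  linfun (ext_mx_fun h).

Lemma ext_mxM X Y Z (h' : hom Y Z) (h : hom X Y) :
  ext_mx (h' \oc h) = (ext_mx h' \o ext_mx h)%VF.
Proof.
apply/lfunP => x; rewrite comp_lfunE !lfunE; apply/ffunP => l; rewrite !ffunE.
under [RHS]eq_bigr => j _ do rewrite ffunE linear_sum.
rewrite exchange_big /=; apply: eq_bigr => i _.
rewrite compA -(compA _ h) -mact_gen sum_lfunE; apply: eq_bigr => j _.
by rewrite comp_lfunE !compA.
Qed.

Lemma ext_mx_lin X Y :
  klinear (V := lfun_kmod _ _) (@ext_mx X Y).
Proof.
move=> a h h'; apply/lfunP => x; rewrite add_lfunE scale_lfunE !lfunE.
apply/ffunP => j; rewrite !ffunE scaler_sumr -big_split; apply: eq_bigr => i _ /=.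
by rewrite comp_linr comp_linl mact_lin /= add_lfunE scale_lfunE.
Qed.

Definition ext_from_fun (x : {ffun I X0 -> M}) : M :=
  \sum_i mact (g_[X0] i) (x i).
Definition ext_to_fun (m : M) : {ffun I X0 -> M} := [ffun i => mact (f_[X0] i) m].

Fact ext_from_linear : linear ext_from_fun.
Proof.
move=> a x y; rewrite /ext_from_fun scaler_sumr -big_split /=.
by apply: eq_bigr => i _; rewrite !ffunE linearP.
Qed.
HB.instance Definition _ :=
  GRing.isLinear.Build k {ffun I X0 -> M} M _ ext_from_fun ext_from_linear.
Fact ext_to_linear : linear ext_to_fun.
Proof. by move=> a x y; apply/ffunP => i; rewrite !ffunE linearP. Qed.
HB.instance Definition _ :=
  GRing.isLinear.Build k M {ffun I X0 -> M} _ ext_to_fun ext_to_linear.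

Definition ext_from : 'Hom({ffun I X0 -> M}, M) := linfun ext_from_fun.
Definition ext_to : 'Hom(M, {ffun I X0 -> M}) := linfun ext_to_fun.

Lemma ext_fromK : (ext_from \o ext_to = \1)%VF.
Proof.
apply/lfunP => m; rewrite comp_lfunE !lfunE /= /ext_from_fun.
rewrite -[RHS]id_lfunE -mact1 -[idm X0]comp1l -mact_gen sum_lfunE; apply: eq_bigr => i _.
by rewrite ffunE comp_lfunE comp1l comp1r.
Qed.

Lemma ext_toK : (ext_to \o ext_from = ext_mx (idm X0))%VF.
Proof.
apply/lfunP => x; rewrite comp_lfunE !lfunE; apply/ffunP => j; rewrite !ffunE.
rewrite linear_sum; apply: eq_bigr => i _.
by rewrite comp1r mactM comp_lfunE.
Qed.

Lemma ext_from_act (h : hom X0 X0) :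
  (ext_from \o ext_mx h = mact h \o ext_from)%VF.
Proof.
apply/lfunP => x; rewrite !comp_lfunE !lfunE /= /ext_from_fun linear_sum.
under eq_bigr => j _ do rewrite ffunE linear_sum.
rewrite exchange_big /=; apply: eq_bigr => i _.
rewrite -comp_lfunE -mactM -[h in RHS]comp1l -compA -mact_gen sum_lfunE.
by apply: eq_bigr => j _; rewrite comp_lfunE comp1l !compA.
Qed.

Lemma ext_mx_idem X : (ext_mx (idm X) \o ext_mx (idm X) = ext_mx (idm X))%VF.
Proof. by rewrite -ext_mxM comp1l. Qed.

(** Matrices of components compose like the morphisms, but the matrix of an
    identity is only an idempotent; the functor sends X to the image of this
    idempotent. *)
Lemma evaluation_ess_surj_at : exists F, isomorphic (evaluation F) M.
Proof.
have split_e X : {K : vectType k & {i : 'Hom(K, {ffun I X -> M}) &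
    {r : 'Hom({ffun I X -> M}, K) |
      (r \o i = \1)%VF /\ (i \o r)%VF = ext_mx (idm X)}}}.
  have [K /cid[i /cid[r H]]] := cid (idempotent_splits (ext_mx_idem X)).
  by exists K, i, r.
pose K X := projT1 (split_e X).
pose i X : 'Hom(K X, {ffun I X -> M}) := projT1 (projT2 (split_e X)).
pose r X : 'Hom({ffun I X -> M}, K X) := sval (projT2 (projT2 (split_e X))).
have ri X : (r X \o i X = \1)%VF.
  by case: (svalP (projT2 (projT2 (split_e X)))).
have ir X : (i X \o r X = ext_mx (idm X))%VF.
  by case: (svalP (projT2 (projT2 (split_e X)))).
pose Fmor X Y (h : hom X Y) : vhom (K X) (K Y) := (r Y \o ext_mx h \o i X)%VF.
have Fmor_lin X Y : klinear (@Fmor X Y).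
  move=> a h h'; rewrite /Fmor ext_mx_lin /=.
  by rewrite comp_lfunDr comp_lfunDl -comp_lfunZr -comp_lfunZl.
have Fmor1 X : Fmor X X (idm X) = idm (K X : vect_cat k).
  by rewrite /Fmor -ir comp_lfunA ri comp_lfun1l ri.
have FmorM X Y Z (h' : hom Y Z) (h : hom X Y) :
    Fmor X Z (h' \oc h) = Fmor Y Z h' \oc Fmor X Y h.
  rewrite /Fmor /= -!comp_lfunA (comp_lfunA (i Y)) ir (comp_lfunA (ext_mx (idm Y))).
  by rewrite -ext_mxM comp1l (comp_lfunA (ext_mx h')) -ext_mxM.
pose F := @LinFunctor _ C (vect_cat k) K Fmor Fmor_lin Fmor1 FmorM.
exists F.
pose u : 'Hom(F X0, M) := (ext_from \o i X0)%VF.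
pose v : 'Hom(M, F X0) := (r X0 \o ext_to)%VF.
have vu : (v \o u = \1)%VF.
  by rewrite /v /u -comp_lfunA (comp_lfunA ext_to) ext_toK -ir !comp_lfunA ri
    comp_lfun1l ri.
have uv : (u \o v = \1)%VF.
  rewrite /v /u -comp_lfunA (comp_lfunA (i X0)) ir -ext_toK !comp_lfunA ext_fromK.
  by rewrite comp_lfun1l ext_fromK.
have u_eq s : (u \o fmor F (spt phi s) = smod_act M s \o u)%VF.
  rewrite /= /Fmor /u -mactE.
  rewrite -!comp_lfunA (comp_lfunA (i X0)) ir (comp_lfunA (ext_mx _)) -ext_mxM.
  by rewrite comp1l !comp_lfunA ext_from_act.
clearbody u v.
have v_eq s : (v \o smod_act M s = fmor F (spt phi s) \o v)%VF.
  rewrite -[LHS]comp_lfun1r -uv -comp_lfunA (comp_lfunA _ u) -u_eq.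
  by rewrite !comp_lfunA vu comp_lfun1l.
exists (exist (schur_submod (evaluation F) M) u u_eq).
exists (exist (schur_submod M (evaluation F)) v v_eq).
by split; apply: ksub_inj.
Qed.

End Extension.

Lemma evaluation_equiv : weak_equiv evaluation.
Proof.
split; [exact: evaluation_faithful | exact: evaluation_full |].
by move=> M; apply: evaluation_ess_surj_at.
Qed.

End Evaluation.

(** * Divided powers in coordinates *)

Definition mi_perm d (A : Type) (I : {ffun 'I_d -> A}) (s : 'S_d) : {ffun 'I_d -> A} :=
  [ffun j => I (s j)].

Section TensorCoordinates.
Variables (k : fieldType) (d : nat).
Implicit Types U V W : vectType k.
Local Notation mi V := {ffun 'I_d -> 'I_(\dim {:V})}.
Local Notation tbas V J := (ptens (fun j => (vbasis {:V})`_(J j))).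

Definition tcoef V W (T : 'Hom(tpow d V, tpow d W)) (I : mi W) (J : mi V) : k :=
  T (tbas V J) I.

Definition tkern_fun V W (c : mi W -> mi V -> k) (x : tpow d V) : tpow d W :=
  [ffun I => \sum_J c I J * (x J : k)].

Fact tkern_linear V W c : linear (@tkern_fun V W c).
Proof.
move=> a x y; apply/ffunP => I; rewrite !ffunE scaler_sumr -big_split /=.
apply: eq_bigr => J _; rewrite !ffunE mulrDr; congr (_ + _).
by rewrite /GRing.scale /= mulrCA.
Qed.
HB.instance Definition _ V W c :=
  GRing.isLinear.Build k (tpow d V) (tpow d W) _ (@tkern_fun V W c)
    (@tkern_linear V W c).

Definition tkern V W (c : mi W -> mi V -> k) : 'Hom(tpow d V, tpow d W) :=
  linfun (@tkern_fun V W c).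

Lemma tkernK V W c I J : tcoef (@tkern V W c) I J = c I J.
Proof.
rewrite /tcoef /tkern lfunE /= ffunE (bigD1 J) //= ptens_bas eqxx mulr1.
rewrite big1 ?addr0 // => J' neJ; rewrite ptens_bas (negPf neJ) mulr0 //.
Qed.

Lemma tcoef_inj V W (T T' : 'Hom(tpow d V, tpow d W)) :
  (forall I J, tcoef T I J = tcoef T' I J) -> T = T'.
Proof.
move=> eT; apply/lfunP => x; rewrite (tpow_sum x) !linear_sum.
apply: eq_bigr => J _; rewrite !linearZ /=; congr (_ *: _).
by apply/ffunP => I; apply: eT.
Qed.

Lemma tcoef1 V I J : tcoef (\1%VF : 'End(tpow d V)) I J = (I == J)%:R.
Proof. by rewrite /tcoef id_lfunE ptens_bas. Qed.

Lemma tcoefM U V W (T : 'Hom(tpow d V, tpow d W)) (T' : 'Hom(tpow d U, tpow d V))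
    I J : tcoef (T \o T')%VF I J = \sum_L tcoef T I L * tcoef T' L J.
Proof.
rewrite /tcoef comp_lfunE [T' _ in LHS]tpow_sum linear_sum sum_ffunE.
by apply: eq_bigr => L _; rewrite linearZ ffunE mulrC.
Qed.

Lemma tcoefP V W a (T T' : 'Hom(tpow d V, tpow d W)) I J :
  tcoef (a *: T + T') I J = a * tcoef T I J + tcoef T' I J.
Proof. by rewrite /tcoef add_lfunE scale_lfunE !ffunE. Qed.

Lemma tcoefZ V W a (T : 'Hom(tpow d V, tpow d W)) I J :
  tcoef (a *: T) I J = a * tcoef T I J.
Proof. by rewrite /tcoef scale_lfunE ffunE. Qed.

Lemma tcoef_sum V W (X : finType) (T : X -> 'Hom(tpow d V, tpow d W)) I J :
  tcoef (\sum_x T x) I J = \sum_x tcoef (T x) I J.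
Proof. by rewrite /tcoef sum_lfunE sum_ffunE. Qed.

Lemma tperm_bas V s (J : mi V) :
  tperm_lfun V s (tbas V J) = tbas V (mi_perm J s) :> tpow d V.
Proof.
by rewrite tperm_lfunE; congr ptens; apply: funext => j; rewrite ffunE.
Qed.

Lemma mi_permK (A : Type) (s : 'S_d) (I J : {ffun 'I_d -> A}) :
  mi_perm I s = J <-> I = mi_perm J s^-1.
Proof.
by split=> [<- | ->]; apply/ffunP => j; rewrite !ffunE ?(permK, permKV).
Qed.

(** Place permutations permute the basis tensors, so that equivariance is the
    invariance of the matrix under simultaneous permutation of row and column
    multi-indices. *)
Lemma equivariant_tcoefP V W (T : 'Hom(tpow d V, tpow d W)) :
  reflect (forall s I J, tcoef T (mi_perm I s) (mi_perm J s) = tcoef T I J)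
          (T \in equivariant d V W).
Proof.
have coef_l s I J : tcoef (T \o tperm_lfun V s)%VF I J = tcoef T I (mi_perm J s).
  by rewrite /tcoef comp_lfunE tperm_bas.
have coef_r s I J : tcoef (tperm_lfun W s \o T)%VF (mi_perm I s) J = tcoef T I J.
  rewrite tcoefM (bigD1 I) //= /tcoef tperm_bas ptens_bas eqxx mul1r big1 ?addr0 //.
  move=> L neLI; rewrite tperm_bas ptens_bas.
  case: eqP => [/mi_permK e | _]; last by rewrite mul0r.
  case/eqP: neLI; apply/ffunP => j; rewrite e !ffunE permKV //.
apply: (iffP (equivariantP T)) => [eqT s I J | eqT s].
  by rewrite -coef_l eqT coef_r.
apply: tcoef_inj => I J.
have -> : I = mi_perm (mi_perm I s^-1) s by apply/esym/mi_permK.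
by rewrite coef_l coef_r eqT.
Qed.

Lemma tkern_equivariant V W (c : mi W -> mi V -> k) :
  (forall s I J, c (mi_perm I s) (mi_perm J s) = c I J) ->
  tkern c \in equivariant d V W.
Proof. by move=> cP; apply/equivariant_tcoefP => s I J; rewrite !tkernK. Qed.

End TensorCoordinates.

Section Generator.
Variables (k : fieldType) (d n : nat).
Implicit Types V W : vectType k.
Local Notation mi V := {ffun 'I_d -> 'I_(\dim {:V})}.
Local Notation E := ('rV[k]_n : vectType k).

Definition dmap V W (T : 'Hom(tpow d V, tpow d W)) : dhom d V W :=
  vsproj (dpow d 'Hom(V, W)) ((hom_tens d V W)^-1%VF T).

Lemma dmapE V W (T : 'Hom(tpow d V, tpow d W)) : T \in equivariant d V W ->
  hom_tens d V W (vsval (dmap T)) = T.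
Proof. by move=> eqT; rewrite vsprojK ?hom_tensVK // hom_tensV_dpow. Qed.

Fact schur_point_lin a (s t : schur_alg k n d) :
  dmap (vsval (a *: s + t)) = kadd (kscale a (dmap (vsval s))) (dmap (vsval t)).
Proof.
by apply: dhom_inj; rewrite dhom_linE !dmapE ?subvsP // linearP.
Qed.

Fact schur_point1 : dmap (vsval (1 : schur_alg k n d)) = dhom_id d E.
Proof.
by apply: dhom_inj; rewrite dmapE ?subvsP // dhom_idE schur_oneE.
Qed.

Fact schur_pointM (s t : schur_alg k n d) :
  dmap (vsval (s * t)) = dhom_comp (dmap (vsval s)) (dmap (vsval t)).
Proof.
by apply: dhom_inj; rewrite dhom_compE !dmapE ?subvsP // schur_mulE.
Qed.

Definition schur_inv (f : dhom d E E) : schur_alg k n d :=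
  vsproj _ (hom_tens d E E (vsval f)).

Fact schur_pointK : cancel (fun s : schur_alg k n d => dmap (vsval s)) schur_inv.
Proof. by move=> s; rewrite /schur_inv dmapE ?subvsP // vsvalK. Qed.

Fact schur_invK : cancel schur_inv (fun s : schur_alg k n d => dmap (vsval s)).
Proof.
move=> f; apply: dhom_inj; rewrite dmapE ?subvsP // vsprojK //.
exact: dhom_equivariant.
Qed.

Definition dpow_vect_point : @schur_point k n d (dpow_vect k d) E :=
  @SchurPoint k n d (dpow_vect k d) E _ _ schur_point_lin schur_point1
    schur_pointM schur_pointK schur_invK.

Definition mi_supp (A : finType) (I : {ffun 'I_d -> A}) : {set A} :=
  [set I j | j : 'I_d].

Lemma mi_supp_perm (A : finType) (I : {ffun 'I_d -> A}) s :
  mi_supp (mi_perm I s) = mi_supp I.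
Proof.
apply/setP => a; apply/imsetP/imsetP => [[j _ ->] | [j _ ->]].
  by exists (s j); rewrite ?ffunE.
by exists ((s^-1)%g j); rewrite ?ffunE ?permKV.
Qed.

Lemma card_mi_supp (A : finType) (I : {ffun 'I_d -> A}) : (#|mi_supp I| <= d)%N.
Proof. by apply: (leq_trans (leq_imset_card _ _)); rewrite card_ord. Qed.

Hypothesis n_gt0 : (0 < n)%N.

Lemma dim_rV : \dim {:E} = n.
Proof. by rewrite dimvf /dim /= mul1n. Qed.

Fact E_index_subproof : (0 < \dim {:E})%N.
Proof. by rewrite dim_rV. Qed.

(** Numbers the elements of S by basis vectors of E; the default value is never
    taken on S if S has at most n elements. *)
Definition squeeze V (S : {set 'I_(\dim {:V})}) (i : 'I_(\dim {:V})) : 'I_(\dim {:E}) :=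
  insubd (Ordinal E_index_subproof) (index i (enum S)).

Lemma squeeze_inj V (S : {set 'I_(\dim {:V})}) :
  (#|S| <= n)%N -> {in S &, injective (squeeze S)}.
Proof.
move=> leSn i j Si Sj /(congr1 val).
have lt_idx l : l \in S -> (index l (enum S) < \dim {:E})%N.
  by rewrite dim_rV => Sl; apply: leq_trans leSn; rewrite cardE index_mem mem_enum.
rewrite !val_insubd !lt_idx // => eij.
by rewrite -[i](nth_index i (s := enum S)) ?mem_enum // eij nth_index ?mem_enum.
Qed.

Definition mi_squeeze V S (I : mi V) : mi E := [ffun j => squeeze S (I j)].

Lemma mi_squeeze_inj V (I J : mi V) :
  mi_supp J = mi_supp I -> (#|mi_supp I| <= n)%N ->
  mi_squeeze (mi_supp I) I = mi_squeeze (mi_supp I) J -> I = J.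
Proof.
move=> eqS leSn /ffunP eIJ; apply/ffunP => j; have := eIJ j; rewrite !ffunE.
by move/(squeeze_inj leSn); apply; [|rewrite -eqS]; apply: imset_f.
Qed.

(** The matrix of the map that kills the basis tensors whose support is not S and
    renames the factors of the others; its transpose undoes the renaming. *)
Definition restr_kern V (S : {set 'I_(\dim {:V})}) (I : mi E) (J : mi V) : k :=
  ((mi_supp J == S) && (I == mi_squeeze S J))%:R.

Lemma restr_kern_perm V (S : {set 'I_(\dim {:V})}) s (I : mi E) (J : mi V) :
  restr_kern S (mi_perm I s) (mi_perm J s) = restr_kern S I J.
Proof.
rewrite /restr_kern mi_supp_perm; congr ((_ && _)%:R).
apply/eqP/eqP => [/mi_permK -> | ->]; apply/ffunP => j.
  by rewrite !ffunE permKV.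
by rewrite !ffunE.
Qed.

(** The identity of the tensor power of V is the sum over S of the projections
    onto the spans of the basis tensors with support S.  The support of a
    multi-index has at most min(d, dim V) <= n elements, so that each of these
    spans embeds into the tensor power of [E]. *)
Lemma dpow_vect_generated V : (\dim {:V} <= n)%N || (d <= n)%N ->
  @generated k (dpow_vect k d) E V.
Proof.
move=> small.
pose f S := tkern (restr_kern (V := V) S).
pose g S := tkern (fun I J => restr_kern (V := V) S J I).
have f_eq S : f S \in equivariant d V E.
  exact/tkern_equivariant/restr_kern_perm.
have g_eq S : g S \in equivariant d E V.
  by apply: tkern_equivariant => s I J; apply: restr_kern_perm.
exists {set 'I_(\dim {:V})} (fun S => dmap (f S)) (fun S => dmap (g S)).
apply: dhom_inj; rewrite [RHS]dhom_idE.
have -> : hom_tens d V V (vsval (\big[kadd/kzero]_S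
    ((dmap (g S) : @hom k (dpow_vect k d) E V) \oc dmap (f S)))) =
    \sum_S (g S \o f S)%VF.
  rewrite (big_morph (fun h : dhom d V V => hom_tens d V V (vsval h))
    (id1 := 0) (op1 := +%R)) => [|h h'|]; first last.
  - by rewrite !linear0.
  - by rewrite /= !linearD.
  by apply: eq_bigr => S _; rewrite dhom_compE !dmapE.
apply: tcoef_inj => I J; rewrite tcoef_sum tcoef1 (bigD1 (mi_supp I)) //=.
rewrite [X in _ + X]big1 ?addr0 => [|S neSI]; last first.
  rewrite tcoefM big1 // => L _.
  by rewrite !tkernK /restr_kern eq_sym (negPf neSI) mul0r.
rewrite tcoefM (bigD1 (mi_squeeze (mi_supp I) I)) //= big1 ?addr0; last first.
  by move=> L neL; rewrite !tkernK /restr_kern (negPf neL) andbF mul0r.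
rewrite !tkernK /restr_kern !eqxx mul1r; congr ((nat_of_bool _)%:R).
apply/andP/eqP => [[/eqP eqS /eqP] | <-]; last by rewrite !eqxx.
apply: mi_squeeze_inj => //; case/orP: small; apply: leq_trans.
  by rewrite -[X in (_ <= X)%N]card_ord max_card.
exact: card_mi_supp.
Qed.

End Generator.

Lemma polyfun_le_schur (k : fieldType) (d n : nat) : (0 < n)%N ->
  linear_equivalence (polyfun_le k d n) (schur_mod k n d).
Proof.
move=> n_gt0.
have dimE : (\dim {:('rV[k]_n : vectType k)} <= n)%N by rewrite dim_rV.
pose E : dpow_vect_le k d n := exist (fun V : vectType k => (\dim {:V} <= n)%N) _ dimE.
pose pt := dpow_vect_point k d n.
pose phi : @schur_point k n d (dpow_vect_le k d n) E :=
  @SchurPoint k n d (dpow_vect_le k d n) E _ _ (spt_lin pt) (spt1 pt)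
    (sptM pt) (sptK pt) (spt_invK pt).
apply: weak_equiv_linear_equivalence; apply: (@evaluation_equiv _ _ _ _ _ phi).
move=> [V leVn]; have VE : @generated k (dpow_vect k d) 'rV[k]_n V.
  by apply: dpow_vect_generated; rewrite ?leVn.
exact: (@Generated k (dpow_vect_le k d n) E (exist _ V leVn)
  _ _ _ (gen_sum VE)).
Qed.

Lemma polyfun_schur (k : fieldType) (d n : nat) : (0 < n)%N -> (d <= n)%N ->
  linear_equivalence (polyfun k d) (schur_mod k n d).
Proof.
move=> n_gt0 ledn; apply: weak_equiv_linear_equivalence.
apply: (@evaluation_equiv _ _ _ _ _ (dpow_vect_point k d n)).
by move=> V; apply: dpow_vect_generated; rewrite ?ledn ?orbT.
Qed.

(** * Monomials and the Schur algebra *)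

Lemma sum_mnm1E d N (f : 'I_d -> 'I_N) l :
  (\sum_j U_(f j))%MM l = count_mem l [tuple f j | j < d].
Proof.
rewrite mnm_sumE -sum1_count big_map big_enum_cond [RHS]big_mkcond /=.
by apply: eq_bigr => j _; rewrite mnm1E; case: eqP.
Qed.

(** Both families enumerate the same multiset. *)
Lemma sum_mnm1_perm d N (f g : 'I_d -> 'I_N) :
  (\sum_j U_(f j) = \sum_j U_(g j))%MM ->
  exists s : 'S_d, forall j, g j = f (s j).
Proof.
move=> efg; have : perm_eq [tuple g j | j < d] [tuple f j | j < d].
  by apply/allP => l _; apply/eqP; rewrite -!sum_mnm1E efg.
case/tuple_permP => s /val_inj egf; exists s => j.
by have /(congr1 (fun t => tnth t j)) := egf; rewrite !tnth_mktuple.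
Qed.

Lemma mnm_sum_mnm1 d N (m : 'X_{1..N}) : mdeg m = d ->
  exists f : 'I_d -> 'I_N, m = (\sum_j U_(f j))%MM.
Proof.
move=> <-; rewrite -size_m2s; exists (fun j => tnth (in_tuple (m2s m)) j).
apply/mnmP => l; rewrite sum_mnm1E -[in LHS](s2mK m) mnmE.
congr (count_mem l _); rewrite -[LHS]/(tval (in_tuple (m2s m))).
by rewrite -[LHS]map_tnth_enum.
Qed.

Section SchurMonomials.
Variables (k : fieldType) (n d : nat).
Local Notation E := ('rV[k]_n : vectType k).
Local Notation mi := {ffun 'I_d -> 'I_(\dim {:E})}.
Local Notation S := (schur_alg k n d).
Implicit Types (I J L : mi) (m : 'X_{1..n * n}) (s t : S).

Definition ibas (i : 'I_(\dim {:E})) : 'I_n := cast_ord (dim_rV k n) i.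

Lemma ibas_bij : bijective ibas.
Proof.
by exists (cast_ord (esym (dim_rV k n))) => i; rewrite /ibas (cast_ordK, cast_ordKV).
Qed.

(** The entry (I, J) of the d-th tensor power of a matrix is this monomial in the
    entries of the matrix. *)
Definition tmon I J : 'X_{1..n * n} :=
  (\sum_j U_(mxvec_index (ibas (I j)) (ibas (J j))))%MM.

Lemma mdeg_tmon I J : mdeg (tmon I J) = d.
Proof.
rewrite mdeg_sum (eq_bigr (fun=> 1%N)) => [|j _]; last by rewrite mdeg1.
by rewrite sum1_card card_ord.
Qed.

Lemma mxvec_index_inj (i j i' j' : 'I_n) :
  mxvec_index i j = mxvec_index i' j' -> i = i' /\ j = j'.
Proof.
case: (curry_mxvec_bij n n) => g gK _ eij.
have := gK (i, j) (isT); have := gK (i', j') isT.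
by rewrite /= eij => -> [-> ->].
Qed.

Lemma tmon_perm I J (u : 'S_d) : tmon (mi_perm I u) (mi_perm J u) = tmon I J.
Proof.
rewrite /tmon [RHS](reindex_perm u) /=; apply: eq_bigr => j _.
by rewrite !ffunE.
Qed.

(** The orbits of the symmetric group on pairs of multi-indices are told apart by
    their monomials. *)
Lemma tmon_eq I J I' J' : tmon I J = tmon I' J' ->
  exists s : 'S_d, I' = mi_perm I s /\ J' = mi_perm J s.
Proof.
case/sum_mnm1_perm => s eIJ; exists s.
have ibas_inj := bij_inj ibas_bij.
by split; apply/ffunP => j; rewrite ffunE;
  case/mxvec_index_inj: (eIJ j) => /ibas_inj eI /ibas_inj eJ.
Qed.

Lemma tmon_surj m : mdeg m = d -> exists I J, m = tmon I J.
Proof.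
case/mnm_sum_mnm1 => f ->.
have [invb bK Kb] := ibas_bij.
exists [ffun j => invb (pair_of_mxvec_index (mxvec_indexP (f j))).1].
exists [ffun j => invb (pair_of_mxvec_index (mxvec_indexP (f j))).2].
apply: eq_bigr => j _; rewrite !ffunE !Kb.
by case: (f j) / mxvec_indexP.
Qed.

(** The sum of the matrix units in one orbit of the symmetric group.  Indexing by
    monomials instead of orbits makes the polynomial representations visible; the
    monomials of degree other than d give 0. *)
Definition xi m : S := vsproj _ (tkern (fun I J : mi => (tmon I J == m)%:R)).

Lemma tcoef_xi m I J : tcoef (vsval (xi m)) I J = (tmon I J == m)%:R.
Proof.
rewrite vsprojK ?tkernK //; apply: tkern_equivariant => s I' J'.
by rewrite tmon_perm.
Qed.

Lemma schur_inj s t :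
  (forall I J, tcoef (vsval s) I J = tcoef (vsval t) I J) -> s = t.
Proof. by move=> est; apply: val_inj; apply: tcoef_inj. Qed.

(** The coefficient of [s] on [xi m]: by equivariance it can be read off at any
    pair of multi-indices with monomial m. *)
Definition scoef s m : k :=
  if [pick p : mi * mi | tmon p.1 p.2 == m] is Some p
  then tcoef (vsval s) p.1 p.2 else 0.

Lemma scoef_tmon s I J : scoef s (tmon I J) = tcoef (vsval s) I J.
Proof.
rewrite /scoef; case: pickP => [[I' J'] /= /eqP/tmon_eq[u [-> ->]] | noIJ].
  by have /equivariant_tcoefP -> := subvsP s.
by have := noIJ (I, J); rewrite /= eqxx.
Qed.

Lemma scoefP a s t m : scoef (a *: s + t) m = a * scoef s m + scoef t m.
Proof.
rewrite /scoef; case: pickP => [p _ | _]; last by rewrite mulr0 addr0.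
by rewrite linearP tcoefP.
Qed.
Lemma scoef0 m : scoef 0 m = 0.
Proof.
by have := scoefP (-1) 0 0 m; rewrite scaler0 addr0 mulN1r addNr.
Qed.

Lemma scoef1 I J : scoef 1 (tmon I J) = (I == J)%:R.
Proof. by rewrite scoef_tmon schur_oneE tcoef1. Qed.

Lemma scoef_xiM m m' I J : scoef (xi m * xi m') (tmon I J) =
  \sum_L (tmon I L == m)%:R * (tmon L J == m')%:R.
Proof.
rewrite scoef_tmon schur_mulE tcoefM; apply: eq_bigr => L _.
by rewrite !tcoef_xi.
Qed.

Lemma scoef_xi m I J : scoef (xi m) (tmon I J) = (tmon I J == m)%:R.
Proof. by rewrite scoef_tmon tcoef_xi. Qed.

Lemma xi_eq0 m : mdeg m != d -> xi m = 0.
Proof.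
move=> dm; apply: schur_inj => I J; rewrite tcoef_xi linear0 /tcoef lfunE ffunE.
by case: eqP => // e; rewrite -e mdeg_tmon eqxx in dm.
Qed.

Lemma sum_bmnm (R : pzRingType) (F : 'X_{1..n * n} -> R) I J :
  \sum_(m : 'X_{1..(n * n) < d.+1}) F m * (tmon I J == m)%:R = F (tmon I J).
Proof.
have lt_m : (mdeg (tmon I J) < d.+1)%N by rewrite mdeg_tmon.
rewrite (bigD1 (BMultinom lt_m)) //= eqxx mulr1 big1 ?addr0 // => m ne_m.
case: eqP => [e | _]; last by rewrite mulr0.
by case/eqP: ne_m; apply: val_inj.
Qed.

Lemma xi_sum s : s = \sum_(m : 'X_{1..(n * n) < d.+1}) scoef s m *: xi m.
Proof.
apply: schur_inj => I J; rewrite linear_sum tcoef_sum -scoef_tmon.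
rewrite -(sum_bmnm (scoef s)); apply: eq_bigr => m _.
by rewrite linearZ tcoefZ tcoef_xi.
Qed.


Section MatrixMonomials.
Variable A : comUnitAlgType k.
Implicit Types (g h : 'M[A]_n).

Definition mev g m : A := mmap1 (fun l => mxvec g 0 l) m.

Lemma mev_tmon g I J : mev g (tmon I J) = \prod_j g (ibas (I j)) (ibas (J j)).
Proof.
rewrite /mev /tmon (big_morph (mmap1 _) (id1 := 1) (op1 := *%R)) ?mmap11 //.
  by apply: eq_bigr => j _; rewrite mmap1U mxvecE.
by move=> m m'; apply: commr_mmap1_M => l x; apply: mulrC.
Qed.

Lemma mev1 I J : mev 1%:M (tmon I J) = (I == J)%:R.
Proof.
rewrite mev_tmon; have [-> | neIJ] := eqVneq I J.
  by rewrite big1 // => j _; rewrite mxE eqxx.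
have [j neIj] : exists j, I j != J j.
  by apply/existsP; apply: contraNT neIJ => /existsPn eIJ; apply/eqP/ffunP => j;
     apply/eqP/negPn/eIJ.
rewrite (bigD1 j) //= mxE (bij_eq ibas_bij) (negPf neIj) mul0r //.
Qed.

Lemma mevM g h I J :
  mev (g *m h) (tmon I J) = \sum_L mev g (tmon I L) * mev h (tmon L J).
Proof.
rewrite mev_tmon.
under eq_bigr => j _ do rewrite mxE (reindex ibas (onW_bij _ ibas_bij)) /=.
rewrite bigA_distr_bigA /=; apply: eq_bigr => L _.
by rewrite !mev_tmon -big_split.
Qed.

(** The tensor power of g is the sum of the g^m [xi m]; this identity compares the
    coefficients of the tensor powers of g and h, multiplied in the Schur algebra
    over A, with those of the tensor power of gh. *)
Lemma mev_scoefM g h I J :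
  \sum_(m : 'X_{1..(n * n) < d.+1}) \sum_(m' : 'X_{1..(n * n) < d.+1})
    mev g m * mev h m' * (scoef (xi m * xi m') (tmon I J))%:A =
  mev (g *m h) (tmon I J).
Proof.
rewrite mevM.
transitivity (\sum_L \sum_(m : 'X_{1..(n * n) < d.+1})
  \sum_(m' : 'X_{1..(n * n) < d.+1})
    (mev g m * (tmon I L == m)%:R) * (mev h m' * (tmon L J == m')%:R)).
  rewrite [RHS]exchange_big; apply: eq_bigr => m _.
  rewrite [RHS]exchange_big; apply: eq_bigr => m' _ /=.
  rewrite scoef_xiM scaler_suml mulr_sumr; apply: eq_bigr => L _.
  by rewrite -natrM scaler_nat natrM mulrACA.
apply: eq_bigr => L _; rewrite -(sum_bmnm (mev g)) -(sum_bmnm (mev h)).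
by rewrite mulr_suml; apply: eq_bigr => m _; rewrite mulr_sumr.
Qed.

End MatrixMonomials.

(** A family P of matrices indexed by monomials defines both a polynomial map
    [peval] on n x n matrices and a linear map [mxlin] on the Schur algebra.  For P
    homogeneous of degree d, the first is the second applied to the tensor power;
    this is what [peval1] and [pevalM] express for 1 and for a product. *)
Section PolynomialFamilies.
Variables (D : nat) (P : 'X_{1..n * n} -> 'M[k]_D).

Definition peval (A : comUnitAlgType k) (g : 'M[A]_n) : 'M[A]_D :=
  \sum_(m : 'X_{1..(n * n) < d.+1}) mev g m *: map_mx (in_alg A) (P m).

Definition mxlin s : 'M[k]_D :=
  \sum_(m : 'X_{1..(n * n) < d.+1}) scoef s m *: P m.

Definition pfam_mx : 'M[{mpoly k[n * n]}]_D :=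
  \matrix_(i, j) \sum_(m : 'X_{1..(n * n) < d.+1}) P m i j *: 'X_[m].

Lemma pevalE (A : comUnitAlgType k) (g : 'M[A]_n) :
  peval g = map_mx (mmap (in_alg A) (fun l => mxvec g 0 l)) pfam_mx.
Proof.
apply/matrixP => i j; rewrite summxE !mxE raddf_sum; apply: eq_bigr => m _.
by rewrite !mxE /= mmapZ mmapX mulrC.
Qed.

Hypothesis P_homog : forall m, mdeg m != d -> P m = 0.

Lemma pfam_mx_homog i j : pfam_mx i j \is d.-homog.
Proof.
rewrite mxE rpred_sum // => m _; have [dm | /P_homog ->] := eqVneq (mdeg m) d.
  by rewrite rpredZ // dhomogX; apply/eqP.
by rewrite mxE scale0r rpred0.
Qed.

Lemma mxlin_xi m : mxlin (xi m) = P m.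
Proof.
have [dm | ndm] := eqVneq (mdeg m) d; last first.
  by rewrite P_homog // /mxlin xi_eq0 // big1 // => t _;
    rewrite scoef0 scale0r.
have lt_m : (mdeg m < d.+1)%N by rewrite dm.
rewrite /mxlin (bigD1 (BMultinom lt_m)) //= big1 ?addr0 => [|t ne_t].
  by have [I [J ->]] := tmon_surj dm; rewrite scoef_xi eqxx scale1r.
have [dt | /P_homog ->] := eqVneq (mdeg t) d; last by rewrite scaler0.
have [I [J et]] := tmon_surj dt; rewrite et scoef_xi -et.
by case: eqP => [e | _]; [case/eqP: ne_t; apply: val_inj | rewrite scale0r].
Qed.

Lemma mxlinP a s t : mxlin (a *: s + t) = a *: mxlin s + mxlin t.
Proof.
rewrite /mxlin scaler_sumr -big_split; apply: eq_bigr => m _ /=.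
by rewrite scoefP scalerDl scalerA.
Qed.

Lemma mxlin0 : mxlin 0 = 0.
Proof. by rewrite /mxlin big1 // => m _; rewrite scoef0 scale0r. Qed.

Lemma mxlinZ a s : mxlin (a *: s) = a *: mxlin s.
Proof. by rewrite -[a *: s]addr0 mxlinP mxlin0 addr0. Qed.

Lemma mxlin_sum (T : finType) (F : T -> S) :
  mxlin (\sum_x F x) = \sum_x mxlin (F x).
Proof.
apply: big_morph => [s t|]; last exact: mxlin0.
by rewrite -[s]scale1r mxlinP !scale1r.
Qed.

Lemma peval1 (A : comUnitAlgType k) :
  peval (1%:M : 'M[A]_n) = map_mx (in_alg A) (mxlin 1).
Proof.
rewrite /mxlin raddf_sum; apply: eq_bigr => m _; rewrite /= map_mxZ.
have [dm | /P_homog ->] := eqVneq (mdeg m) d; last by rewrite map_mx0 !scaler0.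
by have [I [J ->]] := tmon_surj dm; rewrite mev1 scoef1 rmorph_nat.
Qed.

Lemma pevalM (A : comUnitAlgType k) (g h : 'M[A]_n) : peval (g *m h) =
  \sum_(m : 'X_{1..(n * n) < d.+1}) \sum_(m' : 'X_{1..(n * n) < d.+1})
    (mev g m * mev h m') *: map_mx (in_alg A) (mxlin (xi m * xi m')).
Proof.
transitivity (\sum_(t : 'X_{1..(n * n) < d.+1})
  \sum_(m : 'X_{1..(n * n) < d.+1}) \sum_(m' : 'X_{1..(n * n) < d.+1})
    (mev g m * mev h m' * (scoef (xi m * xi m') t)%:A) *:
      map_mx (in_alg A) (P t)).
  apply: eq_bigr => t _.
  have [dt | /P_homog ->] := eqVneq (mdeg t) d; last first.
    rewrite map_mx0 scaler0 big1 // => m _; rewrite big1 // => m' _.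
    by rewrite scaler0.
  have [I [J ->]] := tmon_surj dt.
  rewrite -mev_scoefM scaler_suml; apply: eq_bigr => m _.
  by rewrite scaler_suml.
rewrite exchange_big; apply: eq_bigr => m _.
rewrite exchange_big; apply: eq_bigr => m' _.
rewrite /mxlin raddf_sum scaler_sumr; apply: eq_bigr => t _ /=.
by rewrite map_mxZ scalerA.
Qed.

End PolynomialFamilies.

Lemma homog_peval D (Q : 'M[{mpoly k[n * n]}]_D) (A : comUnitAlgType k)
    (g : 'M[A]_n) : (forall i j, Q i j \is d.-homog) ->
  map_mx (mmap (in_alg A) (fun l => mxvec g 0 l)) Q =
  peval (fun m => \matrix_(i, j) (Q i j)@_m) g.
Proof.
move=> Q_homog; apply/matrixP => i j; rewrite summxE !mxE.
have size_Q : (msize (Q i j) <= d.+1)%N.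
  rewrite mmeasureE; apply/bigmax_leqP_seq => m Qm _.
  by have /dhomogP/(_ m Qm) := Q_homog i j; rewrite /= => ->.
by rewrite (mmapE _ size_Q); apply: eq_bigr => m _; rewrite !mxE mulrC.
Qed.

End SchurMonomials.

(** * Generic matrices *)

Section FractionAlgebra.
Variables (k : fieldType) (R : idomainType).

(** A copy of the field of fractions for each [iota], which makes it a k-algebra. *)
Definition fracalg (iota : {rmorphism k -> R}) := {fraction R}.
HB.instance Definition _ iota := GRing.Field.on (fracalg iota).

Variable iota : {rmorphism k -> R}.
Local Notation F := (fracalg iota).

Definition fracalg_scale (a : k) (x : F) : F := tofrac (iota a) * x.

Fact fracalg_scaleA a b x :
  fracalg_scale a (fracalg_scale b x) = fracalg_scale (a * b) x.
Proof. by rewrite /fracalg_scale rmorphM tofracM mulrA. Qed.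
Fact fracalg_scale1 : left_id 1 fracalg_scale.
Proof. by move=> x; rewrite /fracalg_scale rmorph1 tofrac1 mul1r. Qed.
Fact fracalg_scaleDr : right_distributive fracalg_scale +%R.
Proof. by move=> a x y; rewrite /fracalg_scale mulrDr. Qed.
Fact fracalg_scaleDl x : {morph fracalg_scale^~ x : a b / a + b}.
Proof. by move=> a b; rewrite /fracalg_scale rmorphD tofracD mulrDl. Qed.
HB.instance Definition _ := GRing.Zmodule_isLmodule.Build k F
  fracalg_scaleA fracalg_scale1 fracalg_scaleDr fracalg_scaleDl.

Fact fracalg_scaleAl (a : k) (x y : F) : a *: (x * y) = a *: x * y.
Proof. exact: mulrA. Qed.
HB.instance Definition _ := GRing.Lmodule_isLalgebra.Build k F fracalg_scaleAl.
HB.instance Definition _ := GRing.Lalgebra_isComAlgebra.Build k F.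

Lemma fracalgE (a : k) : a%:A = tofrac (iota a) :> F.
Proof. by rewrite -[LHS]/(tofrac (iota a) * 1) mulr1. Qed.

Variable n : nat.

Definition fracmx (X : 'M[R]_n) : 'M[F]_n := map_mx (@tofrac R) X.

Lemma fracmx_unit X : \det X != 0 -> fracmx X \in unitmx.
Proof. by move=> X0; rewrite unitmxE unitfE det_map_mx tofrac_eq0. Qed.

Lemma mev_fracmx X m :
  mev (fracmx X) m = tofrac (mmap1 (fun l => mxvec X 0 l) m).
Proof.
rewrite rmorph_prod; apply: eq_bigr => l _.
by rewrite /fracmx -map_mxvec mxE rmorphXn.
Qed.

(** A relation between the monomials of matrices over R can be read in R. *)
Lemma fracmx_indep d (X Y : 'M[R]_n) (p q : nat)
    (C : 'X_{1..n * n} -> 'X_{1..n * n} -> 'M[k]_(p, q)) i j :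
  \sum_(m : 'X_{1..(n * n) < d}) \sum_(m' : 'X_{1..(n * n) < d})
    (mev (fracmx X) m * mev (fracmx Y) m') *: map_mx (in_alg F) (C m m') = 0 ->
  \sum_(m : 'X_{1..(n * n) < d}) \sum_(m' : 'X_{1..(n * n) < d})
    mmap1 (fun l => mxvec X 0 l) m * mmap1 (fun l => mxvec Y 0 l) m' *
      iota (C m m' i j) = 0.
Proof.
move=> sum0; apply/eqP; rewrite -tofrac_eq0; apply/eqP.
transitivity ((0 : 'M[F]_(p, q)) i j); last by rewrite mxE.
rewrite -sum0 summxE rmorph_sum; apply: eq_bigr => m _.
rewrite summxE rmorph_sum; apply: eq_bigr => m' _.
by rewrite !mxE /= fracalgE !mev_fracmx !tofracM.
Qed.

End FractionAlgebra.

Section GenericMatrix.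
Variables (B : idomainType) (n : nat).
Local Notation N := (n * n)%N.

Definition genmx : 'M[{mpoly B[N]}]_n := \matrix_(i, j) 'X_(mxvec_index i j).

(** The generic matrix specializes to the identity matrix. *)
Lemma det_genmx : \det genmx != 0.
Proof.
apply/eqP => /(congr1 (meval (fun l => mxvec (1%:M : 'M[B]_n) 0 l))).
rewrite -det_map_mx rmorph0 /=.
have -> : map_mx (meval (fun l => mxvec (1%:M : 'M[B]_n) 0 l)) genmx = 1%:M.
  by apply/matrixP => i j; rewrite !mxE mevalXU mxvecE mxE.
by rewrite det1 => /eqP; rewrite oner_eq0.
Qed.

Lemma genmx_var l : mxvec genmx 0 l = 'X_l.
Proof. by case/mxvec_indexP: l => i j; rewrite mxvecE mxE. Qed.

Lemma mmap1_genmx m : mmap1 (fun l => mxvec genmx 0 l) m = 'X_[m].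
Proof. by rewrite (mmap1_eq _ genmx_var) mmap1_id. Qed.

Lemma mpolyX_indep d (a : 'X_{1..N < d} -> B) :
  \sum_(m : 'X_{1..N < d}) (a m)%:MP * 'X_[m] = 0 :> {mpoly B[N]} -> forall m, a m = 0.
Proof.
move=> sum0 m; move/(congr1 (mcoeff m)): sum0.
rewrite raddf_sum raddf0 (bigD1 m) //= mcoeffCM mcoeffX eqxx mulr1 big1 ?addr0 //.
move=> t ne_t; rewrite mcoeffCM mcoeffX.
by case: eqP => [e | _]; [case/eqP: ne_t; apply: val_inj | rewrite mulr0].
Qed.

Lemma mpolyX_sum2 d (b : 'X_{1..N < d} -> B) (c : 'X_{1..N < d} -> 'X_{1..N < d} -> B) :
  \sum_m \sum_(m' : 'X_{1..N < d}) (b m)%:MP * 'X_[m'] * (c m m')%:MP =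
  \sum_(m' : 'X_{1..N < d}) (\sum_m c m m' * b m)%:MP * 'X_[m'] :> {mpoly B[N]}.
Proof.
rewrite exchange_big; apply: eq_bigr => m' _ /=.
rewrite raddf_sum mulr_suml; apply: eq_bigr => m _ /=.
by rewrite mpolyCM mulrC mulrA.
Qed.

End GenericMatrix.

Section TwoGenericMatrices.
Variables (k : fieldType) (n : nat) (B : idomainType) (iota : {rmorphism k -> B}).
Local Notation N := (n * n)%N.
Local Notation R := {mpoly B[N]}.

Lemma mmap1_genmxC (X : 'M[B]_n) m :
  mmap1 (fun l => mxvec (map_mx (@mpolyC N B) X) 0 l) m =
  (mmap1 (fun l => mxvec X 0 l) m)%:MP.
Proof.
rewrite rmorph_prod; apply: eq_bigr => l _.
by rewrite -map_mxvec mxE rmorphXn.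
Qed.

Definition polyconst : {rmorphism k -> R} := (@mpolyC N B) \o iota.

(** Adjoining the entries of a generic matrix h to a ring B that contains those of
    X: the coefficients of the monomials in h in a relation are relations over B. *)
Lemma add_generic_matrix (X : 'M[B]_n) : \det X != 0 ->
  exists (A : comUnitAlgType k) (g h : 'M[A]_n),
    [/\ g \in unitmx, h \in unitmx &
      forall d p q (C : 'X_{1..N} -> 'X_{1..N} -> 'M[k]_(p, q)),
        \sum_(m : 'X_{1..N < d}) \sum_(m' : 'X_{1..N < d})
          (mev g m * mev h m') *: map_mx (in_alg A) (C m m') = 0 ->
        forall (m' : 'X_{1..N < d}) i j, \sum_(m : 'X_{1..N < d})
          iota (C m m' i j) * mmap1 (fun l => mxvec X 0 l) m = 0].
Proof.
move=> X0; exists (fracalg polyconst).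
exists (fracmx polyconst (map_mx (@mpolyC N B) X)), (fracmx polyconst (genmx B n)).
split=> [||d p q C sum0 m' i j].
- by apply: fracmx_unit; rewrite det_map_mx mpolyC_eq0.
- exact/fracmx_unit/det_genmx.
have {sum0} := fracmx_indep i j sum0.
under eq_bigr => t _ do under eq_bigr => t' _ do rewrite mmap1_genmx mmap1_genmxC.
rewrite (mpolyX_sum2 (fun t => mmap1 (fun l => mxvec X 0 l) t)
  (fun t t' => iota (C t t' i j))).
by move/mpolyX_indep/(_ m').
Qed.

End TwoGenericMatrices.

(** For two generic matrices, with entries in independent variables, the products
    of a monomial in g and a monomial in h are linearly independent over k. *)
Lemma generic_matrices (k : fieldType) (n : nat) :
  exists (A : comUnitAlgType k) (g h : 'M[A]_n),
    [/\ g \in unitmx, h \in unitmx &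
      forall d p q (C : 'X_{1..n * n} -> 'X_{1..n * n} -> 'M[k]_(p, q)),
        \sum_(m : 'X_{1..(n * n) < d}) \sum_(m' : 'X_{1..(n * n) < d})
          (mev g m * mev h m') *: map_mx (in_alg A) (C m m') = 0 ->
        forall m m' : 'X_{1..(n * n) < d}, C m m' = 0].
Proof.
pose B : idomainType := {mpoly k[n * n]}.
pose iota : {rmorphism k -> B} := @mpolyC (n * n) k.
have [A [g [h [gU hU indep]]]] := @add_generic_matrix k n B iota _ (det_genmx k n).
exists A, g, h; split=> // d p q C /indep sum0 m m'.
apply/matrixP => i j; rewrite mxE; have := sum0 m' i j.
under eq_bigr => t _ do rewrite mmap1_genmx.
by move/mpolyX_indep/(_ m).
Qed.

Lemma generic_matrix (k : fieldType) (n : nat) :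
  exists (A : comUnitAlgType k) (g : 'M[A]_n), g \in unitmx /\
      forall d p q (C : 'X_{1..n * n} -> 'M[k]_(p, q)),
        \sum_(m : 'X_{1..(n * n) < d.+1})
          mev g m *: map_mx (in_alg A) (C m) = 0 ->
        forall m : 'X_{1..(n * n) < d.+1}, C m = 0.
Proof.
have [A [g [h [gU _ indep]]]] := generic_matrices k n.
exists A, g; split=> // d p q C sum0 m.
have lt0 : (mdeg (0%MM : 'X_{1..n * n}) < d.+1)%N by rewrite mdeg0.
have := indep d.+1 p q (fun t t' => if t' == 0%MM then C t else 0).
(* The relation is extended by 0 to the products with nontrivial h-monomials. *)
move/(_ _ m (BMultinom lt0)); rewrite /= eqxx; apply.
rewrite -[RHS]sum0; apply: eq_bigr => t _.
rewrite (bigD1 (BMultinom lt0)) //= eqxx [mev h _]mmap11 mulr1.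
rewrite big1 ?addr0 // => t' ne_t'; rewrite ifN ?map_mx0 ?scaler0 //.
Qed.

(** * Schur modules and polynomial representations *)

Section MatrixOfLinearMap.
Variables (k : fieldType) (V W : vectType k).

Definition colmx_fun (M : 'M[k]_(\dim {:W}, \dim {:V})) (v : V) : W :=
  \sum_i (\sum_j M i j * coord (vbasis {:V}) j v) *: (vbasis {:W})`_i.

Fact colmx_fun_linear M : linear (colmx_fun M).
Proof.
move=> a u v; rewrite /colmx_fun scaler_sumr -big_split; apply: eq_bigr => i _ /=.
rewrite scalerA -scalerDl mulr_sumr -big_split; congr (_ *: _).
by apply: eq_bigr => j _; rewrite linearP mulrDr mulrCA.
Qed.
HB.instance Definition _ M :=
  GRing.isLinear.Build k V W _ (colmx_fun M) (colmx_fun_linear M).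

Definition colmx_lfun M : 'Hom(V, W) := linfun (colmx_fun M).

Lemma colmx_lfunK : cancel colmx_lfun (@lfun_colmx k V W).
Proof.
move=> M; apply/matrixP => i j; rewrite mxE lfunE /= /colmx_fun linear_sum.
rewrite (bigD1 i) //= linearZ /= crd_bas eqxx mulr1 (bigD1 j) //= crd_bas eqxx mulr1.
rewrite big1 ?addr0 => [|j' ne_j]; last by rewrite crd_bas (negPf ne_j) mulr0.
rewrite big1 ?addr0 // => i' ne_i.
by rewrite linearZ /= crd_bas eq_sym (negPf ne_i) mulr0.
Qed.

Lemma lfun_colmx_inj : injective (@lfun_colmx k V W).
Proof.
move=> f g /matrixP efg; apply/lfunP => v.
rewrite (crd_sum v) !linear_sum; apply: eq_bigr => j _; rewrite !linearZ /=.
congr (_ *: _); rewrite (crd_sum (f _)) (crd_sum (g _)).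
by apply: eq_bigr => i _; have := efg i j; rewrite !mxE => ->.
Qed.

End MatrixOfLinearMap.

Section SchurToGL.
Variables (k : fieldType) (n d : nat).
Local Notation S := (schur_alg k n d).
Local Notation N := (n * n)%N.

Section OnObjects.
Variable M : schur_module k n d.

Definition act_coef (m : 'X_{1..N}) : 'M[k]_(\dim {:M}) :=
  lfun_colmx (smod_act M (xi k d m)).

Lemma act_coef_homog m : mdeg m != d -> act_coef m = 0.
Proof. by move=> dm; rewrite /act_coef xi_eq0 // !linear0. Qed.

Lemma mxlin_act s : mxlin act_coef s = lfun_colmx (smod_act M s).
Proof.
rewrite {2}(xi_sum s) !linear_sum; apply: eq_bigr => m _.
by rewrite !linearZ.
Qed.

(** The action on M of the tensor power of g. *)
Definition schur_gl_act (A : comUnitAlgType k) (g : 'M[A]_n) :=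
  peval d act_coef g.

Fact schur_gl_act1 (A : comUnitAlgType k) : schur_gl_act (1%:M : 'M[A]_n) = 1%:M.
Proof.
rewrite /schur_gl_act (peval1 act_coef_homog) mxlin_act smod_act1 lfun_colmx1.
exact: map_mx1.
Qed.

Fact schur_gl_actM (A : comUnitAlgType k) (g h : 'M[A]_n) :
  g \in unitmx -> h \in unitmx ->
  schur_gl_act (g *m h) = schur_gl_act g *m schur_gl_act h.
Proof.
move=> _ _; rewrite /schur_gl_act (pevalM act_coef_homog) /peval mulmx_suml.
apply: eq_bigr => m _; rewrite mulmx_sumr; apply: eq_bigr => m' _.
rewrite -scalemxAl -scalemxAr scalerA -map_mxM mxlin_act smod_actM.
by rewrite lfun_colmxM.
Qed.

Fact schur_gl_act_nat (A B : comUnitAlgType k) (phi : {lrmorphism A -> B})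
    (g : 'M[A]_n) : g \in unitmx ->
  schur_gl_act (map_mx phi g) = map_mx phi (schur_gl_act g).
Proof.
move=> _; rewrite /schur_gl_act /peval raddf_sum; apply: eq_bigr => m _ /=.
rewrite map_mxZ /=; congr (_ *: _).
  rewrite /mev /mmap1 rmorph_prod; apply: eq_bigr => l _.
  by rewrite rmorphXn -map_mxvec mxE.
by apply/matrixP => i j; rewrite !mxE /= rmorph_alg.
Qed.

Definition schur_gl : gl_module k n :=
  GLModule schur_gl_act1 schur_gl_actM schur_gl_act_nat.

Fact schur_gl_pol : is_pol_homog d schur_gl.
Proof.
exists (pfam_mx d act_coef); split=> [i j | A g _].
  exact/pfam_mx_homog/act_coef_homog.
by rewrite -pevalE.
Qed.

End OnObjects.

Definition schur_gl_obj (M : schur_mod k n d) : gl_pol_mod k n d :=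
  exist _ _ (schur_gl_pol M).

Fact schur_gl_mor_subproof (L M : schur_module k n d) (f : 'Hom(L, M)) :
  schur_equivariant f -> gl_equivariant (V := schur_gl L) (W := schur_gl M) f.
Proof.
move=> f_eq A g _; rewrite /= /schur_gl_act /peval mulmx_suml mulmx_sumr.
apply: eq_bigr => m _; rewrite -scalemxAr -scalemxAl -!map_mxM.
by rewrite -!lfun_colmxM f_eq.
Qed.

Definition schur_gl_mor (L M : schur_mod k n d) (f : hom L M) :
  hom (schur_gl_obj L) (schur_gl_obj M) :=
  exist (gl_submod (schur_gl L) (schur_gl M)) (sval f)
    (schur_gl_mor_subproof (svalP f)).

Lemma schur_gl_mor_inj (L M : schur_mod k n d)
    (f g : hom (schur_gl_obj L) (schur_gl_obj M)) : sval f = sval g -> f = g.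
Proof. exact: (@ksub_inj _ _ (gl_submod (schur_gl L) (schur_gl M))). Qed.

Definition schur_to_gl : linfunctor (schur_mod k n d) (gl_pol_mod k n d).
Proof.
refine (@LinFunctor _ (schur_mod k n d) (gl_pol_mod k n d) schur_gl_obj
  schur_gl_mor _ _ _).
- by move=> L M a f g; apply: (@schur_gl_mor_inj L M).
- by move=> M; apply: (@schur_gl_mor_inj M M).
- by move=> L M N' g f; apply: (@schur_gl_mor_inj L N').
Defined.

Lemma schur_to_gl_faithful : faithful schur_to_gl.
Proof. by move=> L M f g /(congr1 sval) efg; apply: ksub_inj. Qed.

(** A map that commutes with a generic matrix commutes with the coefficient of
    each monomial, that is, with the action of each [xi]. *)
Lemma schur_to_gl_full : full schur_to_gl.
Proof.
move=> L M [f f_eq]; simpl in f, f_eq.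
have f_xi m : mdeg m = d ->
    (f \o smod_act L (xi k d m) = smod_act M (xi k d m) \o f)%VF.
  move=> dm; have lt_m : (mdeg m < d.+1)%N by rewrite dm.
  apply: lfun_colmx_inj; rewrite !lfun_colmxM; apply/eqP; rewrite -subr_eq0; apply/eqP.
  have [A [g [gU indep]]] := generic_matrix k n.
  apply: (indep d _ _ (fun m => lfun_colmx f *m act_coef L m -
    act_coef M m *m lfun_colmx f) _ (BMultinom lt_m)).
  have := f_eq A g gU; rewrite /= /schur_gl_act /peval.
  rewrite mulmx_suml mulmx_sumr => /eqP; rewrite -subr_eq0 -sumrB => /eqP sum0.
  rewrite -[RHS]sum0; apply: eq_bigr => t _.
  by rewrite -scalemxAr -scalemxAl -scalerBr -!map_mxM map_mxB.
have f_schur : schur_equivariant f.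
  move=> s; rewrite (xi_sum s) !linear_sum comp_lfun_suml comp_lfun_sumr.
  apply: eq_bigr => m _; rewrite !linearZ -comp_lfunZl -comp_lfunZr.
  have [dm | dm] := eqVneq (mdeg m) d; first by rewrite f_xi.
  by rewrite xi_eq0 // !linear0 comp_lfun0l comp_lfun0r.
by exists (exist _ f f_schur); apply: (@schur_gl_mor_inj L M).
Qed.

Lemma schur_scalel a (s t : S) : (a *: s) * t = a *: (s * t).
Proof.
by apply: val_inj; rewrite linearZ /= !schur_mulE linearZ /= comp_lfunZl.
Qed.

Lemma schur_scaler a (s t : S) : s * (a *: t) = a *: (s * t).
Proof.
by apply: val_inj; rewrite linearZ /= !schur_mulE linearZ /= comp_lfunZr.
Qed.

Section FromGL.
Variables (V : gl_module k n) (Q : 'M[{mpoly k[N]}]_(\dim {:V})).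
Hypothesis Q_homog : forall i j, Q i j \is d.-homog.
Hypothesis QE : forall (A : comUnitAlgType k) (g : 'M[A]_n), g \in unitmx ->
  gl_act V g = map_mx (mmap (in_alg A) (fun l => mxvec g 0 l)) Q.

Let P (m : 'X_{1..N}) : 'M[k]_(\dim {:V}) := \matrix_(i, j) (Q i j)@_m.

Let P_homog m : mdeg m != d -> P m = 0.
Proof.
by move=> dm; apply/matrixP => i j; rewrite !mxE (dhomog_nemf_coeff (Q_homog i j)).
Qed.

Lemma gl_act_peval (A : comUnitAlgType k) (g : 'M[A]_n) : g \in unitmx ->
  gl_act V g = peval d P g.
Proof. by move=> gU; rewrite QE // (homog_peval _ Q_homog). Qed.

Lemma mxlin_gl1 : mxlin P (1 : S) = 1%:M.
Proof.
have := gl_act1 V (k^o : comUnitAlgType k).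
rewrite gl_act_peval ?unitmx1 // (peval1 P_homog) => /matrixP e1.
by apply/matrixP => i j; have := e1 i j; rewrite !mxE /= /GRing.scale /= mulr1.
Qed.

(** The coefficient of g^m h^m' in the identity P(gh) = P(g)P(h), for generic g
    and h. *)
Lemma mxlin_glxiM (m m' : 'X_{1..N < d.+1}) :
  mxlin P (xi k d m * xi k d m' : S) = P m *m P m'.
Proof.
have [A [g [h [gU hU indep]]]] := generic_matrices k n.
have := @gl_actM _ _ V A g h gU hU.
rewrite !gl_act_peval ?unitmx_mul ?gU // (pevalM P_homog) /peval mulmx_suml.
move/eqP; rewrite -subr_eq0 -sumrB => /eqP sum0.
apply/eqP; rewrite -subr_eq0; apply/eqP.
apply: (indep d.+1 _ _
  (fun m m' => mxlin P (xi k d m * xi k d m' : S) - P m *m P m')).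
rewrite -[RHS]sum0; apply: eq_bigr => t _; rewrite mulmx_sumr -sumrB.
apply: eq_bigr => t' _.
by rewrite -scalemxAl -scalemxAr scalerA -scalerBr -map_mxM map_mxB.
Qed.

Lemma mxlin_glM (s t : S) : mxlin P (s * t) = mxlin P s *m mxlin P t.
Proof.
have -> : s * t = \sum_(m : 'X_{1..N < d.+1}) \sum_(m' : 'X_{1..N < d.+1})
    (scoef s m * scoef t m') *: (xi k d m * xi k d m').
  rewrite [in LHS](xi_sum s) [in LHS](xi_sum t) mulr_suml; apply: eq_bigr => m _.
  rewrite mulr_sumr; apply: eq_bigr => m' _.
  by rewrite schur_scalel schur_scaler scalerA.
rewrite mxlin_sum {2 3}/mxlin mulmx_suml; apply: eq_bigr => m _.
rewrite mxlin_sum mulmx_sumr; apply: eq_bigr => m' _.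
by rewrite mxlinZ mxlin_glxiM -scalemxAl -scalemxAr scalerA.
Qed.

Definition gl_schur_act (s : S) : 'End(V) := colmx_lfun (mxlin P s).

Lemma colmx_gl_schur_act s : lfun_colmx (gl_schur_act s) = mxlin P s.
Proof. exact: colmx_lfunK. Qed.

Fact gl_schur_act_linear : linear gl_schur_act.
Proof.
move=> a s t; apply: lfun_colmx_inj; rewrite linearP /= !colmx_gl_schur_act.
exact: mxlinP.
Qed.
HB.instance Definition _ :=
  GRing.isLinear.Build k S 'End(V) _ gl_schur_act gl_schur_act_linear.

Fact gl_schur_act1 : gl_schur_act 1 = \1%VF.
Proof.
by apply: lfun_colmx_inj; rewrite lfun_colmx1 colmx_gl_schur_act mxlin_gl1.
Qed.

Fact gl_schur_actM s t : gl_schur_act (s * t) = (gl_schur_act s \o gl_schur_act t)%VF.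
Proof.
by apply: lfun_colmx_inj; rewrite lfun_colmxM !colmx_gl_schur_act mxlin_glM.
Qed.

Definition gl_schur : schur_module k n d := SchurModule gl_schur_act1 gl_schur_actM.

Lemma schur_gl_gl_schur (A : comUnitAlgType k) (g : 'M[A]_n) : g \in unitmx ->
  gl_act (schur_gl gl_schur) g = gl_act V g.
Proof.
move=> gU; rewrite gl_act_peval //; apply: eq_bigr => m _.
by rewrite /act_coef /= colmx_gl_schur_act mxlin_xi.
Qed.

End FromGL.

(** The identity map of V is the isomorphism: the module built from the
    coefficients of V has the same action on invertible matrices. *)
Lemma schur_to_gl_ess_surj : ess_surj schur_to_gl.
Proof.
move=> [V [Q [Q_homog QE]]].
exists (gl_schur Q_homog QE).
have id1 : gl_submod (schur_gl (gl_schur Q_homog QE)) V \1%VF.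
  by move=> A g gU; rewrite lfun_colmx1 map_mx1 mul1mx mulmx1 schur_gl_gl_schur.
have id2 : gl_submod V (schur_gl (gl_schur Q_homog QE)) \1%VF.
  by move=> A g gU; rewrite lfun_colmx1 map_mx1 mul1mx mulmx1 schur_gl_gl_schur.
exists (exist _ _ id1), (exist _ _ id2).
by split; apply: ksub_inj; apply: comp_lfun1l.
Qed.

Lemma schur_to_gl_equiv : weak_equiv schur_to_gl.
Proof.
split; [exact: schur_to_gl_faithful | exact: schur_to_gl_full
  | exact: schur_to_gl_ess_surj].
Qed.

End SchurToGL.

(** * The equivalences *)

Theorem theorem1p2 (p : nat) (k : fieldType) (charkp : p \in [pchar k]%R)
    (d n : nat) (n_gt0 : (0 < n)%N) :
  [/\ abelian_equivalence (polyfun_le k d n) (schur_mod k n d),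
      abelian_equivalence (polyfun_le k d n) (gl_pol_mod k n d)
    & (d <= n)%N -> abelian_equivalence (polyfun_le k d n) (polyfun k d)].
Proof.
have le_schur := polyfun_le_schur k d n_gt0.
have ab := @functor_cat_abelian k (dpow_vect_le k d n).
split=> [||ledn]; apply: linear_equivalence_abelian => //.
  apply: linear_equivalence_trans le_schur _.
  exact/weak_equiv_linear_equivalence/schur_to_gl_equiv.
exact: linear_equivalence_trans le_schur
  (linear_equivalence_sym (polyfun_schur k n_gt0 ledn)).
Qed.
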